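(* Let $N=(N_1,\dots,N_d)$ be a multivariate Hawkes process with parameters $\mu=(\mu_1,\dots,\mu_d)\in[0,\infty)^d$ and $\boldsymbol{\varphi}=(\varphi_{ij})_{1\le i,j\le d}$, $\varphi_{ij}:[0,\infty)\to[0,\infty)$. Assume that $\int_0^\infty\varphi_{ij}(t)\,dt<\infty$ for all $i,j$ and that the spectral radius of the matrix $\mathbf K=\int_0^\infty\boldsymbol{\varphi}(t)\,dt$ satisfies $\rho(\mathbf K)<1$. Then $N_t\in L^2(P)$ for all $t\ge 0$, and $$\sup_{v\in[0,1]}\bigl\|T^{-1}N_{Tv}-v\,(\mathbf{Id}-\mathbf K)^{-1}\mu\bigr\|\to 0\quad\text{as }T\to\infty,$$ almost surely and in $L^2(P)$.
   Context: A multivariate Hawkes process with parameters $(\mu,\boldsymbol\varphi)$ is defined as follows. Let $(T_n)_{n\ge1}$ be a non-decreasing sequence of random variables with values in $(0,\infty]$ with $T_n<T_{n+1}$ on $\{T_n<\infty\}$, and $(Z_n)_{n\ge1}$ random variables with values in $\{1,\dots,d\}$. Put $N_{i,t}=\sum_{n\ge1}\mathbf 1_{\{T_n\le t\}\cap\{Z_n=i\}}$ for $t\ge0$ (so $N_{i,0}=0$ and no two components jump simultaneously) and let $\mathscr F_t=\sigma(N_{i,s}:s\le t,\,1\le i\le d)$. Let $\mu_i\ge 0$ and let $\varphi_{ij}:[0,\infty)\to[0,\infty)$ be (Borel) functions. $N$ is a Hawkes process under $P$ if for all $n\ge1$ and $i$ the process $N_{i,t\wedge T_n}-\int_0^{t\wedge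 T_n}\lambda_{i,s}\,ds$ is an $(\mathscr F_t)$-martingale, where $$\lambda_{i,t}=\mu_i+\int_{(0,t)}\sum_{j=1}^d\varphi_{ij}(t-s)\,dN_{j,s}.$$ No stationarity is assumed. $\mu$ and $N_t$ are regarded as column vectors, $\|\cdot\|$ is the Euclidean norm on $\mathbb R^d$, integrals of matrices are componentwise, and $\mathbf{Id}$ is the $d\times d$ identity matrix. *)

(* Defs.v *)
From mathcomp Require Import all_boot all_order all_algebra.
From mathcomp Require Import complex.
From mathcomp Require Import all_classical all_reals all_analysis.
From mathcomp Require Import measurable_realfun.

Set Implicit Arguments.
Unset Strict Implicit.
Unset Printing Implicit Defensive.
Import Order.TTheory GRing.Theory Num.Theory.
Import numFieldNormedType.Exports.
Local Open Scope classical_set_scope.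
Local Open Scope ring_scope.

(* Maximal modulus of the complex eigenvalues; the set of eigenvalues is finite,
   and nonempty for d > 0, so the supremum is a maximum. *)
Definition spectral_radius (R : realType) (d : nat) (A : 'M[R]_d) : R :=
  sup [set ComplexField.Normc.normc z |
        z in [set z : R[i] | eigenvalue (map_mx (real_complex R) A) z]].

(* Euclidean norm of a vector with entries in \bar R: +oo as soon as one entry is
   infinite. *)
Definition enorm2 (R : realType) (d : nat) (x : 'I_d -> \bar R) : \bar R :=
  ((\sum_(i < d) `|x i| `^ 2) `^ (2^-1))%E.

Definition in_L2 (disp : measure_display) (Omega : measurableType disp)
    (R : realType) (P : probability Omega R) (X : Omega -> \bar R) : Prop :=
  measurable_fun [set: Omega] X /\ (Lnorm P 2%:E X < +oo)%E.

(* Y is a version of E[X | G]. *)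
Definition is_cond_expectation (disp : measure_display)
    (Omega : measurableType disp) (R : realType) (P : probability Omega R)
    (G : set_system Omega) (X Y : Omega -> \bar R) : Prop :=
  [/\ preimage_set_system setT Y measurable `<=` G,
      P.-integrable setT Y &
      forall A, G A -> (\int[P]_(w in A) Y w = \int[P]_(w in A) X w)%E].

Definition is_martingale (disp : measure_display)
    (Omega : measurableType disp) (R : realType) (P : probability Omega R)
    (F : R -> set_system Omega) (M : R -> Omega -> \bar R) : Prop :=
  [/\ forall t : R, 0 <= t -> preimage_set_system setT (M t) measurable `<=` F t,
      forall t : R, 0 <= t -> P.-integrable setT (M t) &
      forall s t : R, 0 <= s -> s <= t ->
        is_cond_expectation P (F s) (M t) (M s)].

(* A marked point process is given by its jump times tau and its marks Z, with
   indices shifted by one: tau n and Z n stand for T_{n+1} and Z_{n+1}. Mark Z n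
   is irrelevant on {tau n = +oo}. Explosion is not excluded a priori, so counts
   and intensities take values in [0, +oo]. *)
Section hawkes.
Context (disp : measure_display) (Omega : measurableType disp) (R : realType).
Context (P : probability Omega R) (d : nat).
Context (tau : nat -> Omega -> \bar R) (Z : nat -> Omega -> 'I_d).
Context (mu : 'cV[R]_d) (phi : 'I_d -> 'I_d -> R -> R).

Definition is_marked_point_process : Prop :=
  [/\ forall n, measurable_fun setT (tau n),
      forall n i, measurable (Z n @^-1` [set i]),
      forall n w, (0 < tau n w)%E,
      forall n w, (tau n w <= tau n.+1 w)%E &
      forall n w, (tau n w < +oo)%E -> (tau n w < tau n.+1 w)%E].

Definition jump_count (i : 'I_d) (t : R) (w : Omega) : \bar R :=
  (\sum_(0 <= n <oo) (\1_[set v | (tau n v <= t%:E)%E /\ Z n v = i] w)%:E)%E.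

(* The Stieltjes measure of t |-> jump_count i t w: one atom of mass 1 at each jump
   time of mark i. *)
Definition jump_measure (i : 'I_d) (w : Omega) : {measure set R -> \bar R} :=
  mseries (fun n => if (tau n w < +oo)%E && (Z n w == i)
                    then (\d_(fine (tau n w)) : {measure set R -> \bar R})
                    else (mzero : {measure set R -> \bar R})) 0.

Definition history (t : R) : set_system Omega :=
  <<s [set A | exists (i : 'I_d) (s : R),
         [/\ 0 <= s, s <= t & preimage_set_system setT (jump_count i s) measurable A]] >>.

Definition intensity (i : 'I_d) (t : R) (w : Omega) : \bar R :=
  ((mu i ord0)%:E +
   \sum_(j < d) \int[jump_measure j w]_(s in `]0%R, t[) (phi i j (t - s))%:E)%E.

Definition stopped_time (n : nat) (t : R) (w : Omega) : R :=
  fine (Order.min t%:E (tau n w)).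

(* No +oo - +oo arises: at most n.+1 jumps occur up to tau n. *)
Definition compensated_count (n : nat) (i : 'I_d) (t : R) (w : Omega) : \bar R :=
  (jump_count i (stopped_time n t w) w -
   \int[lebesgue_measure]_(s in `[0%R, stopped_time n t w]) intensity i s w)%E.

Definition is_hawkes : Prop :=
  is_marked_point_process /\
  forall n i, is_martingale P history (compensated_count n i).

Definition kernel_integral : 'M[R]_d :=
  \matrix_(i < d, j < d) Rintegral lebesgue_measure `[0, +oo[ (phi i j).

(* invmx is the genuine inverse when the spectral radius of the kernel integral
   is less than 1. *)
Definition lln_limit : 'cV[R]_d := invmx (1%:M - kernel_integral) *m mu.

Definition lln_error (T : R) (w : Omega) : \bar R :=
  ereal_sup [set enorm2 (fun i : 'I_d =>
                  ((T^-1)%:E * jump_count i (T * v) w - (v * lln_limit i ord0)%:E)%E)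
            | v in `[0, 1]].

End hawkes.

(* Main.v *)
Require Import Defs.
From mathcomp Require Import all_boot all_order all_algebra.
From mathcomp Require Import complex.
From mathcomp Require Import all_classical all_reals all_analysis.
From mathcomp Require Import measurable_realfun.
From mathcomp Require Import ring lra.
Import Order.TTheory GRing.Theory Num.Theory.
Import numFieldNormedType.Exports.
Set Implicit Arguments.
Unset Strict Implicit.
Unset Printing Implicit Defensive.
Local Open Scope classical_set_scope.
Local Open Scope ring_scope.

(** Write N for the counting process, A for its compensator, M = N - A and
    m = (Id - K)^-1 mu. Everything is first done for the processes stopped at the
    n-th jump, where N is bounded by n and A is bounded and continuous, uniformly in
    the randomness.

    Taking expectations in A <= mu t + K N gives E N_t <= t m, because (Id - K)^-1
    has nonnegative entries; in particular there is no explosion. Along a fine grid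
    (dM)^2 <= (dN)^2 + (dA)^2, where the sum of the (dN)^2 tends to N and that of the
    (dA)^2 to 0, so E M_t^2 <= E N_t, and Doob's inequality bounds the second moment
    of M* = max_{s <= T} |M_s| by a multiple of T.

    Pathwise, A_t = mu t + int_0^t phi(s) N_{t-s} ds. Inserting |N_s - s m| <= X for
    s <= T shows X <= M* + o(T) + K X componentwise, hence X <= (Id - K)^-1 (M* + o(T))
    with a deterministic o(T). This gives the convergence in L^2; the bound O(1/T) on
    the second moment of the random part of X / T gives almost sure convergence along
    T = 2^k, and monotonicity of T |-> sup_{t <= T} |N_t - t m| fills the gaps. *)

(** * The inverse of Id - K *)

(** The martingale property is only given up to each [tau n]. Estimates are therefore made for fixed
    n on {T < tau n} with constants free of n, and [le_integral_before] removes n at the end. The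
    grid size depends on n and T, which is harmless because the second-moment bounds do not involve
    it. Stopping also keeps X finite, without which X <= y + K X could not be inverted.

    The spectral radius enters only through the invertibility of Id - tK for 0 <= t <= 1;
    continuation along this segment, and no power series, carries nonnegativity from Id to (Id -
    K)^-1.

    Since the kernels are merely integrable, the deterministic remainder comes as e T + D with e > 0
    arbitrary and D depending on e. Hence the quantity with second moment O(1/T) is the positive
    part of V_T - e, where V_T is [lln_error] at T, and both limits are derived from it before e is
    sent to 0. *)

Lemma cvg_sumr (R : realType) (T I : Type) (F : set_system T) (FF : Filter F)
    (r : seq I) (f : I -> T -> R) (l : I -> R) :
  (forall i, f i x @[x --> F] --> l i) ->
  \sum_(i <- r) f i x @[x --> F] --> \sum_(i <- r) l i.
Proof.
move=> fl; apply: cvg_big => // -[a b].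
exact: (continuousD (f := fst) (g := snd) cvg_fst cvg_snd).
Qed.

Section nonneg_matrix.
Context (R : realType) (d : nat).
Implicit Types A K : 'M[R]_d.

(** The supremum dominates the moduli only if they are bounded: every eigenvalue is a root of the
    characteristic polynomial, so the sum of the moduli of its roots is an upper bound. *)
Lemma eigenvalue_le_spectral_radius A (z : R[i]) :
  eigenvalue (map_mx (real_complex R) A) z ->
  ComplexField.Normc.normc z <= spectral_radius A.
Proof.
move=> Az; apply: ub_le_sup; last by exists z.
have [rs char_rs] := closed_field_poly_normal (char_poly (map_mx (real_complex R) A)).
exists (\sum_(y <- rs) ComplexField.Normc.normc y) => _ [y /= Ay <-].
have : y \in rs.
  move: Ay; rewrite eigenvalue_root_char char_rs (monicP (char_poly_monic _)).
  by rewrite scale1r root_prod_XsubC.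
move=> /(big_rem y) ->; rewrite lerDl; apply: sumr_ge0 => -[a b] _.
exact: sqrtr_ge0.
Qed.

(** A nonzero row vector with v = t v K makes 1/t >= 1 an eigenvalue of [K], against the bound on
    the spectral radius. *)
Lemma unitmx_sub_scale K (t : R) : spectral_radius K < 1 -> 0 <= t <= 1 ->
  1%:M - t *: K \in unitmx.
Proof.
move=> rho1 /andP[t0 t1]; rewrite unitmxE unitfE; apply/negP => /det0P[v v0].
rewrite mulmxBr mulmx1 -scalemxAr => /eqP; rewrite subr_eq0 => /eqP vK.
have tn0 : t != 0.
  by apply: contra_neq v0 => t0'; rewrite vK t0' scale0r.
have tgt0 : 0 < t by rewrite lt_def tn0.
have : eigenvalue (map_mx (real_complex R) K) (real_complex R t^-1).
  apply/eigenvalueP; exists (map_mx (real_complex R) v); last first.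
    apply: contra_neq v0 => /matrixP v0; apply/matrixP => i j.
    by have := v0 i j; rewrite !mxE => -[].
  rewrite -map_mxM -map_mxZ; congr map_mx.
  by rewrite [in RHS]vK scalerA mulVf// scale1r.
move=> /eigenvalue_le_spectral_radius /= K1.
have : t^-1 < 1.
  apply: le_lt_trans rho1; apply: le_trans K1.
  by rewrite expr0n/= addr0 sqrtr_sqr ler_norm.
by rewrite invf_lt1// ltNge t1.
Qed.

(* At an index where x is minimal, a negative value would force the i-th entry of
   x - A x to be negative. *)
Lemma mulmx_sub_ge0 A (x : 'cV[R]_d) : (forall i j, 0 <= A i j) ->
  (forall i, \sum_j A i j < 1) -> (forall i, 0 <= (x - A *m x) i ord0) ->
  forall i, 0 <= x i ord0.
Proof.
move=> A0 A1 xA i.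
have [k _ kmin] := arg_minP (fun i => x i ord0) (isT : xpredT i).
apply: le_trans (kmin i isT).
have := xA k; rewrite !mxE subr_ge0 => Ax.
have : x k ord0 * \sum_j A k j <= x k ord0.
  rewrite (le_trans _ Ax)// mulr_sumr; apply: ler_sum => j _.
  by rewrite mulrC ler_wpM2l// kmin.
by have := A1 k; nra.
Qed.

(** Cramer's rule: each entry of the inverse is a quotient of polynomials in t whose denominator has
    no zero on [0, 1], hence continuous on a compact interval. *)
Lemma invmx_sub_scale_bounded K : spectral_radius K < 1 ->
  exists C : R, forall t, 0 <= t <= 1 -> forall i j,
    `|invmx (1%:M - t *: K) i j| <= C.
Proof.
move=> rho1.
(* Over polynomials, the adjugate and the determinant are polynomials in t, and evaluation commutes
   with both. *)
pose A : 'M[{poly R}]_d := 1%:M - 'X *: map_mx polyC K.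
have AE t : map_mx (horner_eval t) A = 1%:M - t *: K.
  apply/matrixP => i j; rewrite !mxE /horner_eval !hornerE/=.
  by rewrite hornerMn hornerC.
pose f t := \sum_i \sum_j `|(\adj A i j).[t] / (\det A).[t]|.
have detA t : (\det A).[t] = \det (1%:M - t *: K).
  by rewrite -AE det_map_mx.
have invE t i j : 0 <= t <= 1 ->
    invmx (1%:M - t *: K) i j = (\adj A i j).[t] / (\det A).[t].
  move=> t01; have := unitmx_sub_scale rho1 t01; rewrite /invmx => ->.
  rewrite [LHS]mxE mulrC detA -AE; congr (_ / _).
  by rewrite -map_mx_adj [LHS]mxE.
have cf : {within `[0, 1], continuous f}.
  apply/continuous_in_subspaceT => t; rewrite inE/= in_itv/= => t01.
  have dn0 : (\det A).[t] != 0.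
    by have := unitmx_sub_scale rho1 t01; rewrite unitmxE unitfE detA.
  apply: cvg_sumr => i; apply: cvg_sumr => j; apply: cvg_norm.
  apply: cvgM; first exact: continuous_horner.
  by apply: cvgV => //; exact: continuous_horner.
have [c _ cmax] := EVT_max (ler01 : (0 : R) <= 1) cf.
exists (f c) => t t01 i j; rewrite invE//.
have ft : f t <= f c by apply: cmax; rewrite in_itv.
apply: le_trans ft.
rewrite /f (bigD1 i)//= (bigD1 j)//= -addrA lerDl addr_ge0 ?sumr_ge0// => k _.
by rewrite sumr_ge0.
Qed.

(** Nonnegativity is continued from t = 0 to t = 1 in equal steps h. With B the inverse at t, Id -
    (t + h)K = (Id - tK)(Id - hBK), and hBK is nonnegative with row sums below 1, so [mulmx_sub_ge0]
    applies to each column of the inverse at t + h. *)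
Lemma invmx_sub_ge0 K : (forall i j, 0 <= K i j) -> spectral_radius K < 1 ->
  forall i j, 0 <= invmx (1%:M - K) i j.
Proof.
move=> K0 rho1; have [C boundC] := invmx_sub_scale_bounded rho1.
(* [c] bounds the row sums of BK for every t, so one step length serves the whole segment; n + 1
   steps of length 1/(n + 1) end exactly at 1. *)
pose c := Num.max C 0 * \sum_i \sum_j K i j.
have c0 : 0 <= c.
  apply: mulr_ge0; first by rewrite le_max lexx orbT.
  by apply: sumr_ge0 => i _; apply: sumr_ge0.
pose n := Num.truncn c; pose h : R := n.+1%:R^-1.
have h0 : 0 < h by rewrite invr_gt0.
have hc : h * c < 1.
  by rewrite mulrC ltr_pdivrMr// mul1r truncnS_gt.
have step t : 0 <= t -> t + h <= 1 ->
    (forall i j, 0 <= invmx (1%:M - t *: K) i j) ->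
    forall i j, 0 <= invmx (1%:M - (t + h) *: K) i j.
  move=> t0 th1 Bt0 i j.
  have t01 : 0 <= t <= 1 by rewrite t0 (le_trans _ th1)// lerDl ltW.
  have th01 : 0 <= t + h <= 1 by rewrite th1 addr_ge0// ltW.
  have ut := unitmx_sub_scale rho1 t01; have uth := unitmx_sub_scale rho1 th01.
  pose B := invmx (1%:M - t *: K).
  pose A := h *: (B *m K).
  have A0 k l : 0 <= A k l.
    rewrite !mxE mulr_ge0 ?(ltW h0)// sumr_ge0// => m _.
    by rewrite mulr_ge0// Bt0.
  have A1 k : \sum_l A k l < 1.
    apply: le_lt_trans hc.
    under eq_bigr do rewrite !mxE.
    rewrite -mulr_sumr ler_wpM2l ?(ltW h0)// exchange_big/= /c mulr_sumr.
    apply: ler_sum => l _; rewrite -mulr_sumr ler_wpM2r//.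
      by rewrite sumr_ge0.
    rewrite le_max; apply/orP; left; apply: le_trans (boundC _ t01 k l).
    exact: ler_norm.
  have -> : invmx (1%:M - (t + h) *: K) i j
      = col j (invmx (1%:M - (t + h) *: K)) i ord0 by rewrite mxE.
  (* The vector is the j-th column of the new inverse; [1%:M - A] maps it to the j-th column of [B],
     which is already known to be nonnegative. *)
  apply: (mulmx_sub_ge0 A0 A1) => k.
  rewrite -{1}[col j _]mul1mx -mulmxBl colE mulmxA -colE mxE.
  suff -> : (1%:M - A) *m invmx (1%:M - (t + h) *: K) = B by exact: Bt0.
  have -> : 1%:M - A = B *m (1%:M - (t + h) *: K).
    rewrite scalerDl opprD addrA mulmxBr mulVmx// -scalemxAr; congr (_ - _).
  by rewrite mulmxK.
have ind k : (k <= n.+1)%N -> forall i j, 0 <= invmx (1%:M - (k%:R * h) *: K) i j.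
  elim: k => [_ i j|k IH kn].
    by rewrite mul0r scale0r subr0 invmx1 mxE ler0n.
  have -> : k.+1%:R * h = k%:R * h + h by rewrite -natr1 mulrDl mul1r.
  apply: step; last exact/IH/ltnW.
    by rewrite mulr_ge0// ltW.
  by rewrite -[X in _ + X]mul1r -mulrDl natr1 ler_pdivrMr// mul1r ler_nat.
have := ind n.+1 (leqnn _); rewrite divff ?pnatr_eq0// scale1r.
exact.
Qed.

End nonneg_matrix.

Section nonneg_inverse.
Context (R : realType) (d : nat) (K : 'M[R]_d).
Hypothesis K_ge0 : forall i j, 0 <= K i j.
Hypothesis rho_lt1 : spectral_radius K < 1.

Lemma unitmx_sub : 1%:M - K \in unitmx.
Proof.
by have := unitmx_sub_scale rho_lt1 (t := 1); rewrite scale1r; apply; rewrite ler01 lexx.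
Qed.

(** Multiplication by a nonnegative matrix preserves (Id - K) x <= y. This serves twice: for x = E
    N_t, and for x the largest deviation of a path. *)
Lemma le_invmx_sub (x y : 'I_d -> R) :
  (forall i, x i <= y i + \sum_j K i j * x j) ->
  forall i, x i <= \sum_j invmx (1%:M - K) i j * y j.
Proof.
move=> xy i; pose X := \col_j x j; pose Y := \col_j y j.
have -> : x i = (invmx (1%:M - K) *m ((1%:M - K) *m X)) i ord0.
  by rewrite mulKmx ?unitmx_sub// mxE.
rewrite mxE; apply: ler_sum => j _; rewrite ler_wpM2l ?invmx_sub_ge0//.
rewrite mulmxBl mul1mx !mxE lerBlDr; apply: le_trans (xy j) _.
by rewrite lerD2l; apply: ler_sum => k _; rewrite mxE.
Qed.

End nonneg_inverse.

(** * Convolution kernels *)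

Section shift.
Context (R : realType).
Local Notation mu := (@lebesgue_measure R).

Lemma lebesgue_measure_shift (c : R) (A : set R) : measurable A ->
  mu ((fun x => x - c) @^-1` A) = mu A.
Proof.
move=> mA.
have ms : measurable_fun [set: measurableTypeR R]
    ((fun x => x - c) : measurableTypeR R -> measurableTypeR R).
  by apply: measurable_funB => //; exact: measurable_id.
apply/esym; apply: (@lebesgue_measure_unique R
  (measure_function_pushforward__canonical__measure_function_Measure mu ms)) => //.
move=> _ [[a b] /= _ <-]; rewrite /pushforward.
have -> : (fun x : R => x - c) @^-1` `]a, b] = `]a + c, b + c]%classic.
  by apply/seteqP; split => x /=; rewrite !in_itv/= ltrBrDr lerBlDr.
rewrite !lebesgue_measure_itv/= !lte_fin ltrD2r; case: ifP => // _.
by rewrite -!EFinB; congr EFin; lra.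
Qed.

Lemma ge0_integral_shift (c : R) (D : set R) (f : R -> \bar R) :
  measurable D -> measurable_fun D f -> (forall x, D x -> (0 <= f x)%E) ->
  (\int[mu]_(x in (fun x => (x - c)%R) @^-1` D) f (x - c)%R = \int[mu]_(x in D) f x)%E.
Proof.
move=> mD mf f0.
have ms : measurable_fun [set: measurableTypeR R]
    ((fun x => x - c) : measurableTypeR R -> measurableTypeR R).
  by apply: measurable_funB => //; exact: measurable_id.
have := @ge0_integral_pushforward _ _ _ _ R _ ms mu D f mD mf.
move=> <-; last by move=> x /[!inE]; exact: f0.
apply: eq_measure_integral => A mA _.
exact: lebesgue_measure_shift.
Qed.

End shift.

Section kernel.
Context (R : realType) (g : R -> R).
Local Notation mu := (@lebesgue_measure R).
Hypothesis g_ge0 : forall t : R, 0 <= t -> 0 <= g t.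
Hypothesis g_meas : measurable_fun (`[0, +oo[ : set R) g.
Hypothesis g_int : (\int[mu]_(t in `[0%R, +oo[) (g t)%:E < +oo)%E.

(** [g] is only constrained on [0, +oo[, while shifts and reflections of the kernel call for a
    function measurable on the whole line. *)
Let g0 : R -> R := g \_ (`[0, +oo[ : set R).

Let g0_ge0 t : 0 <= g0 t.
Proof.
rewrite /g0 /patch; case: ifPn => //; rewrite inE/= in_itv/= andbT.
exact: g_ge0.
Qed.

Let measurable_g0 : measurable_fun setT g0.
Proof. by apply/(measurable_restrictT _ _).1. Qed.

Let integrable_g0 : mu.-integrable setT (EFin \o g0).
Proof.
apply/integrableP; split; first exact/measurable_EFinP.
rewrite (_ : (\int[mu]_x `|(EFin \o g0) x|)%E = (\int[mu]_(t in `[0%R, +oo[) (g t)%:E)%E)//.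
rewrite [RHS]integral_mkcond; apply: eq_integral => x _.
rewrite /= ger0_norm// /g0 /patch; by case: ifP.
Qed.

(** Integrating from -oo makes this primitive vanish at negative arguments, so that [cumul (t - c)]
    is zero by itself before a jump at c. *)
Definition cumul (x : R) : R := \int[mu]_(s in `]-oo, x]) g0 s.

Let cumulE x : ((cumul x)%:E = \int[mu]_(s in `]-oo, x]) (g0 s)%:E)%E.
Proof.
rewrite fineK//; apply: integrable_fin_num => //.
exact: (integrableS measurableT).
Qed.

Lemma integral_cumul x : (\int[mu]_(s in `[0%R, x]) (g s)%:E = (cumul x)%:E)%E.
Proof.
rewrite cumulE integral_mkcond [RHS]integral_mkcond.
apply: eq_integral => s _; rewrite /patch /g0 /patch.
rewrite !mem_setE !in_itv/= andbT.
by case: (leP 0 s) => s0/=; case: (leP s x).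
Qed.

Lemma integral_kernel : (\int[mu]_(t in `[0%R, +oo[) (g t)%:E
  = (\int[mu]_(t in `[0%R, +oo[) g t)%:E)%E.
Proof.
rewrite fineK// ge0_fin_numE// integral_ge0// => t /=.
by rewrite in_itv/= andbT lee_fin; exact: g_ge0.
Qed.

Lemma cumul_ge0 x : 0 <= cumul x.
Proof. exact: Rintegral_ge0. Qed.

Lemma cumul_lt0 (x : R) : x < 0 -> cumul x = 0.
Proof.
move=> x0; apply/eqP; rewrite -eqe -integral_cumul set_itv_ge ?integral_set0//.
by rewrite bnd_simp -ltNge.
Qed.

Lemma cumul_itvB (a b : R) : a <= b -> cumul b - cumul a = \int[mu]_(s in `]a, b]) g0 s.
Proof.
move=> ab; apply: Rintegral_itvB => //; exact: (integrableS measurableT).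
Qed.

Lemma cumul_nd (a b : R) : a <= b -> cumul a <= cumul b.
Proof. by move=> ab; rewrite -subr_ge0 cumul_itvB// Rintegral_ge0. Qed.

Lemma cumul_le x : cumul x <= \int[mu]_(t in `[0%R, +oo[) g t.
Proof.
rewrite -lee_fin -integral_kernel -integral_cumul.
apply: ge0_subset_integral => //.
- exact/measurable_EFinP.
- by move=> t /=; rewrite in_itv/= andbT lee_fin; exact: g_ge0.
- by move=> t /=; rewrite !in_itv/= => /andP[->].
Qed.

Lemma cumul_unif_continuous (e : R) : 0 < e ->
  exists2 h : R, 0 < h & forall a b : R, a <= b -> b - a < h -> cumul b - cumul a < e.
Proof.
move=> e0; have [h [h0 hP]] := integral_normr_continuous integrable_g0 e0.
exists h => // a b ab bah; rewrite cumul_itvB//.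
have muab : (mu (`]a, b]%classic : set R) < h%:E)%E.
  by rewrite lebesgue_measure_itv/= lte_fin; case: ifP; rewrite -?EFinB lte_fin.
have := hP _ (measurable_itv _) muab.
by under eq_Rintegral do rewrite ger0_norm//.
Qed.

Lemma cumul_cvg (e : R) : 0 < e ->
  exists2 x : R, 0 <= x & (\int[mu]_(t in `[0%R, +oo[) g t) - e <= cumul x.
Proof.
move=> e0.
pose F n : set (measurableTypeR R) := `[0, n%:R]%classic.
have F0 n t : F n t -> 0 <= t by rewrite /F/= in_itv/= => /andP[].
have FE : \bigcup_i F i = `[0, +oo[%classic.
  apply/seteqP; split=> t /=; first by move=> [n _] /F0; rewrite in_itv/= andbT.
  rewrite in_itv/= andbT => t0; exists (Num.truncn t).+1 => //=.
  by rewrite /F/= in_itv/= t0 ltW// truncnS_gt.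
have H : (\int[mu]_(t in F n) (g t)%:E @[n --> \oo]
    --> \int[mu]_(t in \bigcup_i F i) (g t)%:E)%E.
  apply: ge0_nondecreasing_set_cvg_integral => //.
  - move=> m n mn; apply/subsetPset => t; rewrite /F/= !in_itv/= => /andP[-> /le_trans].
    by apply; rewrite ler_nat.
  - by move=> i; exact: measurable_itv.
  - move=> i; apply/measurable_EFinP; apply: measurable_funS g_meas => //.
    by move=> t /F0; rewrite /= in_itv/= andbT.
  - by move=> i t /F0 ?; rewrite lee_fin g_ge0.
move: H; rewrite FE integral_kernel.
under eq_cvg do rewrite /F integral_cumul.
move=> /fine_cvgP[_ H].
move/cvgrPdist_le : H => /(_ _ e0)[n _ /(_ n (leqnn n))]/= H.
by exists n%:R => //; move: H; rewrite ler_norml => /andP[]; lra.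
Qed.

Lemma integral_kernel_cst x (c : R) : 0 <= c ->
  (\int[mu]_(s in `[0%R, x]) (g s * c)%:E = (cumul x * c)%:E)%E.
Proof.
move=> c0; under eq_integral do rewrite EFinM.
rewrite ge0_integralZr//; first by rewrite integral_cumul.
- apply/measurable_EFinP; apply: measurable_funS g_meas => //.
  by move=> t /=; rewrite !in_itv/= => /andP[->].
- by move=> t /=; rewrite !in_itv/= => /andP[? _]; rewrite lee_fin g_ge0.
Qed.

Lemma measurable_kernel_shift (c : R) :
  measurable_fun setT (fun s : R => g0 (s - c)).
Proof. by apply: measurableT_comp => //; apply: measurable_funB. Qed.

Lemma measurable_kernel_reflect (s : R) :
  measurable_fun (`]0, s[ : set R) (fun r => (g (s - r))%:E).
Proof.
apply/measurable_EFinP.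
apply: (@eq_measurable_fun _ _ _ _ _ (fun r : R => g0 (s - r))).
  move=> r; rewrite inE/= in_itv/= => /andP[_ rs].
  by rewrite /g0 /patch mem_set//= in_itv/= andbT subr_ge0 ltW.
apply: measurable_funTS; apply: measurableT_comp => //.
exact: measurable_funB.
Qed.

(** The interval is open at s: a jump at c acts on the intensity strictly after c only. *)
Lemma integral_dirac_kernel (c s : R) : 0 < c ->
  (\int[\d_c]_(r in `]0%R, s[) (g (s - r))%:E
   = (((fun s => g0 (s - c)) \_ (`]c, +oo[ : set R)) s)%:E)%E.
Proof.
move=> c0; rewrite integral_dirac//; last exact: measurable_kernel_reflect.
rewrite diracE /patch !mem_setE !in_itv/= c0 andbT.
case: ltP => cs; rewrite ?mul0e// mul1e /g0 /patch mem_set//=.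
by rewrite in_itv/= andbT subr_ge0 ltW.
Qed.

Lemma measurable_dirac_kernel (c : R) (D : set R) : 0 < c ->
  measurable_fun D (fun s : R => \int[\d_c]_(r in `]0%R, s[) (g (s - r))%:E)%E.
Proof.
move=> c0; under eq_fun do rewrite integral_dirac_kernel//.
have m1 : measurable_fun setT ((fun s : R => g0 (s - c)) \_ (`]c, +oo[ : set R)).
  apply/(measurable_restrictT _ _).1; first exact: measurable_itv.
  by apply: measurable_funTS; exact: measurable_kernel_shift.
by apply/measurable_EFinP; exact: measurable_funTS.
Qed.

(** The contribution of a single jump at c to the integrated intensity. Translation by c brings it
    to the integral of [g] over [0, u - c]; the endpoint c, where the jump does not act yet, is a
    null set. *)
Lemma integral_integral_dirac_kernel (c u : R) : 0 < c ->
  (\int[mu]_(s in `[0%R, u]) \int[\d_c]_(r in `]0%R, s[) (g (s - r))%:E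
   = (cumul (u - c))%:E)%E.
Proof.
move=> c0; under eq_integral do rewrite integral_dirac_kernel//.
rewrite -integral_cumul -(ge0_integral_shift c)//; last 2 first.
- apply/measurable_EFinP; apply: measurable_funS g_meas => //.
  by move=> t /=; rewrite !in_itv/= => /andP[->].
- by move=> t /=; rewrite !in_itv/= => /andP[? _]; rewrite lee_fin g_ge0.
have -> : (fun x => x - c) @^-1` `[0, u - c] = `[c, u]%classic.
  by apply/seteqP; split => x /=; rewrite !in_itv/= subr_ge0 lerD2r.
transitivity (\int[mu]_(s in `]c, u]) (g (s - c))%:E)%E; last first.
  rewrite integral_itv_obnd_cbnd//.
  apply/measurable_EFinP; apply: (@eq_measurable_fun _ _ _ _ _ (fun s : R => g0 (s - c))).
    move=> s; rewrite inE/= in_itv/= => /andP[cs _].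
    by rewrite /g0 /patch mem_set//= in_itv/= andbT subr_ge0 ltW.
  by apply: measurable_funTS; exact: measurable_kernel_shift.
rewrite integral_mkcond [RHS]integral_mkcond; apply: eq_integral => s _.
rewrite /g0 /patch !mem_setE !in_itv/= !andbT subr_ge0.
case: (ltP c s) => cs /=; last by rewrite if_same.
by rewrite (le_trans (ltW c0) (ltW cs)) (ltW cs)/=; case: ifP.
Qed.

End kernel.

(** * Martingales in discrete time *)

Section bounded_random_variables.
Context (disp : measure_display) (Omega : measurableType disp) (R : realType).
Context (P : probability Omega R).
Implicit Types X Y : Omega -> R.

(** A bound valid for all outcomes determines the sign of its constant only if there is an outcome;
    total mass one provides it. *)
Lemma probability_inhabited : inhabited Omega.
Proof.
apply: contrapT => nw; have := @probability_setT _ _ _ P.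
rewrite (_ : setT = set0) ?measure0; first by move/eqP; rewrite eq_sym onee_eq0.
by apply/seteqP; split => // w _; apply: nw; constructor.
Qed.

(** Stopped processes are bounded, and this class is closed under the operations needed below, so
    that real integrals are linear and monotone on it without separate integrability arguments. *)
Definition bounded_rv X :=
  measurable_fun [set: Omega] X /\ exists C : R, forall w, `|X w| <= C.

Lemma bounded_rv_cst (c : R) : bounded_rv (fun=> c).
Proof. by split=> //; exists `|c|. Qed.

Lemma bounded_rvD X Y : bounded_rv X -> bounded_rv Y ->
  bounded_rv (fun w => X w + Y w).
Proof.
move=> [mX [C XC]] [mY [D YD]]; split; first exact: measurable_funD.
by exists (C + D) => w; rewrite (le_trans (ler_normD _ _))// lerD.
Qed.

Lemma bounded_rvM X Y : bounded_rv X -> bounded_rv Y ->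
  bounded_rv (fun w => X w * Y w).
Proof.
move=> [mX [C XC]] [mY [D YD]]; split; first exact: measurable_funM.
by exists (C * D) => w; rewrite normrM ler_pM.
Qed.

Lemma bounded_rvB X Y : bounded_rv X -> bounded_rv Y ->
  bounded_rv (fun w => X w - Y w).
Proof.
move=> bX bY; have := bounded_rvD bX (bounded_rvM (bounded_rv_cst (-1)) bY).
by under eq_fun do rewrite mulN1r.
Qed.

Lemma bounded_rv_norm X : bounded_rv X -> bounded_rv (fun w => `|X w|).
Proof.
move=> [mX [C XC]]; split; last by exists C => w; rewrite normr_id.
exact: measurableT_comp.
Qed.

Lemma bounded_rv_sqr X : bounded_rv X -> bounded_rv (fun w => X w ^+ 2).
Proof. by move=> bX; under eq_fun do rewrite expr2; exact: bounded_rvM. Qed.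

Lemma bounded_rv_indic (A : set Omega) : measurable A -> bounded_rv (\1_A : Omega -> R).
Proof.
move=> mA; split; first exact: measurable_indic.
by exists 1 => w; rewrite indicE; case: (_ \in _); rewrite ?normr1// normr0 ler01.
Qed.

Lemma bounded_rv_sum (I : Type) (r : seq I) (X : I -> Omega -> R) :
  (forall i, bounded_rv (X i)) -> bounded_rv (fun w => \sum_(i <- r) X i w).
Proof.
move=> bX; elim: r => [|i r IH].
  by under eq_fun do rewrite big_nil; exact: bounded_rv_cst.
by under eq_fun do rewrite big_cons; exact: bounded_rvD.
Qed.

Lemma bounded_rv_integrable X : bounded_rv X -> P.-integrable setT (EFin \o X).
Proof.
move=> [mX [C XC]]; apply: measurable_bounded_integrable => //.
  by rewrite ltey_eq fin_num_measure.
exists C; split; first exact: num_real.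
by move=> x Cx w _ /=; rewrite (le_trans (XC w))// ltW.
Qed.

Lemma Rintegral_bounded_rvD X Y : bounded_rv X -> bounded_rv Y ->
  \int[P]_w (X w + Y w) = \int[P]_w X w + \int[P]_w Y w.
Proof. by move=> bX bY; apply: RintegralD => //; exact: bounded_rv_integrable. Qed.

Lemma Rintegral_bounded_rvB X Y : bounded_rv X -> bounded_rv Y ->
  \int[P]_w (X w - Y w) = \int[P]_w X w - \int[P]_w Y w.
Proof. by move=> bX bY; apply: RintegralB => //; exact: bounded_rv_integrable. Qed.

Lemma Rintegral_bounded_rvZ X (c : R) : bounded_rv X ->
  \int[P]_w (c * X w) = c * \int[P]_w X w.
Proof. by move=> bX; apply: RintegralZl => //; exact: bounded_rv_integrable. Qed.

Lemma Rintegral_probability_cst (c : R) : \int[P]_w c = c.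
Proof. by rewrite Rintegral_cst// [X in fine X](@probability_setT _ _ _ P) mulr1. Qed.

Lemma le_Rintegral_bounded_rv X Y : bounded_rv X -> bounded_rv Y ->
  (forall w, X w <= Y w) -> \int[P]_w X w <= \int[P]_w Y w.
Proof.
by move=> bX bY XY; apply: le_Rintegral => //; exact: bounded_rv_integrable.
Qed.

Lemma Rintegral_bounded_rv_sum (I : Type) (r : seq I) (X : I -> Omega -> R) :
  (forall i, bounded_rv (X i)) ->
  \int[P]_w (\sum_(i <- r) X i w) = \sum_(i <- r) \int[P]_w X i w.
Proof.
move=> bX; elim: r => [|i r IH].
  under eq_Rintegral do rewrite big_nil.
  by rewrite Rintegral_probability_cst big_nil.
under eq_Rintegral do rewrite big_cons.
by rewrite Rintegral_bounded_rvD ?IH ?big_cons//; exact: bounded_rv_sum.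
Qed.

Lemma EFin_Rintegral_bounded_rv X : bounded_rv X ->
  (\int[P]_w X w)%:E = (\int[P]_w (X w)%:E)%E.
Proof.
by move=> bX; rewrite fineK// integrable_fin_num//; exact: bounded_rv_integrable.
Qed.

End bounded_random_variables.

Section conditionally_centered.
Context (disp : measure_display) (Omega : measurableType disp) (R : realType).
Context (P : probability Omega R) (S : set_system Omega).
Hypothesis S_sub : <<s S >> `<=` measurable.

Lemma measurable_fun_sub (X : g_sigma_algebraType S -> R) :
  measurable_fun setT X -> measurable_fun [set: Omega] X.
Proof. by move=> mX mT B mB; apply: S_sub; exact: (mX measurableT B mB). Qed.

(** This is E[D | S] = 0 tested on events; the indicator in the integrand keeps a real integral over
    the whole space. *)
Definition centered_on (D : Omega -> R) :=
  forall A, <<s S >> A -> \int[P]_w (\1_A w * D w) = 0.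

(* Subtracting (c / 2) 1_{xi >= c / 2} from xi halves its range without changing
   the integral against D. *)
Lemma centered_dyadic (D : Omega -> R) : bounded_rv D -> centered_on D ->
  forall (n : nat) (c : R) (xi : g_sigma_algebraType S -> R),
  measurable_fun setT xi -> (forall w, 0 <= xi w <= c) ->
  `|\int[P]_w (xi w * D w)| <= c / 2 ^+ n * \int[P]_w `|D w|.
Proof.
move=> bD D0; elim=> [c xi mxi xic|n IH c xi mxi xic].
  have bxi : bounded_rv (xi : Omega -> R).
    split; first exact: measurable_fun_sub.
    by exists c => w; have /andP[a b] := xic w; rewrite ger0_norm.
  have bxiD := bounded_rvM bxi bD.
  rewrite expr0 divr1; apply: le_trans.
    by apply: le_normr_Rintegral => //; exact: bounded_rv_integrable.
  rewrite -Rintegral_bounded_rvZ; last exact: bounded_rv_norm.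
  apply: le_Rintegral_bounded_rv.
  - exact: bounded_rv_norm.
  - by apply: bounded_rvM; [exact: bounded_rv_cst|exact: bounded_rv_norm].
  - by move=> w; have /andP[a b] := xic w; rewrite normrM (ger0_norm a) ler_wpM2r.
pose A : set (g_sigma_algebraType S) := [set w | c / 2 <= xi w].
have mA : measurable A.
  rewrite (_ : A = setT `&` xi @^-1` `[c / 2, +oo[); first exact: mxi.
  by apply/seteqP; split => w /=; rewrite in_itv/= andbT // => -[].
pose xi' (w : g_sigma_algebraType S) := xi w - c / 2 * \1_A w.
have mxi' : measurable_fun [set: g_sigma_algebraType S] xi'.
  have mI : measurable_fun [set: g_sigma_algebraType S] (\1_A : _ -> R).
    exact: measurable_indic.
  by apply: measurable_funB => //; apply: measurable_funM.
have bxi' : forall w, 0 <= xi' w <= c / 2.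
  move=> w; have := xic w; rewrite /xi' indicE.
  have [cw|cw] := leP (c / 2) (xi w).
    by rewrite mem_set//= mulr1 => /andP[? ?]; apply/andP; split; lra.
  rewrite memNset; last by rewrite /A/=; apply/negP; rewrite -ltNge.
  by rewrite mulr0 subr0 => /andP[? ?]; apply/andP; split; lra.
have bA : bounded_rv (\1_A : Omega -> R).
  by apply: bounded_rv_indic; exact: S_sub.
have bx' : bounded_rv (xi' : Omega -> R).
  split; first exact: measurable_fun_sub.
  by exists (c / 2) => w; have /andP[a b] := bxi' w; rewrite ger0_norm.
have -> : \int[P]_w (xi w * D w) = \int[P]_w (xi' w * D w).
  have -> : \int[P]_w (xi w * D w)
      = \int[P]_w (xi' w * D w + c / 2 * (\1_A w * D w)).
    by apply: eq_Rintegral => w _; rewrite /xi'; ring.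
  rewrite Rintegral_bounded_rvD//.
  - rewrite Rintegral_bounded_rvZ; last exact: bounded_rvM.
    by rewrite D0 ?mulr0 ?addr0//.
  - exact: bounded_rvM.
  - by apply: bounded_rvM; [exact: bounded_rv_cst|exact: bounded_rvM].
apply: le_trans (IH _ _ mxi' bxi') _.
by rewrite exprS invfM mulrA.
Qed.

(** Since E D = 0, [xi] may be shifted by C into [0, 2C]; then n in [centered_dyadic] is free, and
    2^n > n brings the bound below any e > 0. *)
Lemma centered_mul (D : Omega -> R) (xi : g_sigma_algebraType S -> R) (C : R) :
  bounded_rv D -> centered_on D -> measurable_fun setT xi ->
  (forall w, `|xi w| <= C) -> \int[P]_w (xi w * D w) = 0.
Proof.
move=> bD D0 mxi xiC.
have bxi : bounded_rv (xi : Omega -> R).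
  by split; [exact: measurable_fun_sub|exists C].
have ED0 : \int[P]_w D w = 0.
  rewrite -(D0 setT); last first.
    by have := @measurableT _ (g_sigma_algebraType S).
  by apply: eq_Rintegral => w _; rewrite indicT mul1r.
have -> : \int[P]_w (xi w * D w) = \int[P]_w ((xi w + C) * D w).
  under [RHS]eq_Rintegral do rewrite mulrDl.
  rewrite Rintegral_bounded_rvD; last 2 first.
  - exact: bounded_rvM.
  - by apply: bounded_rvM => //; exact: bounded_rv_cst.
  by rewrite Rintegral_bounded_rvZ// ED0 mulr0 addr0.
have mxiC : measurable_fun setT (fun w : g_sigma_algebraType S => xi w + C).
  by apply: measurable_funD.
have bxiC w : 0 <= xi w + C <= C + C.
  by have := xiC w; rewrite ler_norml => /andP[a b]; lra.
apply/eqP; rewrite -normr_le0; apply/ler_addgt0Pl => e e0; rewrite addr0.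
pose a := (C + C) * \int[P]_w `|D w|.
have a0 : 0 <= a.
  rewrite mulr_ge0 ?Rintegral_ge0//.
  by have [w] := probability_inhabited P; have := bxiC w; lra.
apply: le_trans (centered_dyadic bD D0 (Num.truncn (a / e)) mxiC bxiC) _.
rewrite mulrAC -/a ler_pdivrMr ?exprn_gt0// mulrC -ler_pdivrMr//.
apply: le_trans (ltW (truncnS_gt _)) _.
by rewrite -natrX ler_nat ltn_expl.
Qed.

End conditionally_centered.

(** * Doob's inequality as a deterministic statement about one path *)

Section pathwise_doob.
Context (R : realType).

Fixpoint running_max (s : nat -> R) (n : nat) : R :=
  if n is m.+1 then Num.max (running_max s m) (s n) else s 0%N.

Lemma le_running_max (s : nat -> R) n k : (k <= n)%N -> s k <= running_max s n.
Proof.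
elim: n => [|n IH]; first by rewrite leqn0 => /eqP ->.
rewrite leq_eqVlt => /orP[/eqP -> /=|/IH]; first by rewrite le_max lexx orbT.
by move=> /le_trans; apply; rewrite /= le_max lexx.
Qed.

Lemma running_max_sum_le (s : nat -> R) n : (forall k, 0 <= s k) ->
  running_max s n ^+ 2 + 2 * \sum_(i < n) running_max s i * (s i.+1 - s i)
  <= 2 * running_max s n * s n.
Proof.
move=> s0; elim: n => [|n IH].
  by rewrite big_ord0 /=; have := s0 0%N; nra.
rewrite big_ord_recr /=; set a := running_max s n in IH *.
by case: (leP a (s n.+1)) => h; nra.
Qed.

(** With a the maximum and x the last value, 4ax <= a^2 + 4x^2 converts the previous bound; this is
    the origin of the constant 4 in Doob's inequality. For a submartingale the sum has nonnegative
    expectation. *)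
Lemma sqr_running_max_le (s : nat -> R) n : (forall k, 0 <= s k) ->
  running_max s n ^+ 2 + 4 * \sum_(i < n) running_max s i * (s i.+1 - s i)
  <= 4 * s n ^+ 2.
Proof.
move=> s0; have := running_max_sum_le n s0.
set a := running_max s n; set x := s n; set y := \sum_(_ < _) _.
by have := sqr_ge0 (a - 2 * x); nra.
Qed.

End pathwise_doob.

Section discrete_martingale.
Context (disp : measure_display) (Omega : measurableType disp) (R : realType).
Context (P : probability Omega R) (S : nat -> set_system Omega).
Context (M : nat -> Omega -> R).
Hypothesis S_sub : forall k, <<s S k >> `<=` measurable.
Hypothesis S_nd : forall k l, (k <= l)%N -> <<s S k >> `<=` <<s S l >>.
Hypothesis M_adapted : forall k,
  measurable_fun [set: g_sigma_algebraType (S k)] (M k).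
Hypothesis M_bounded : forall k, exists C : R, forall w, `|M k w| <= C.
Hypothesis M_centered : forall k,
  centered_on P (S k) (fun w => M k.+1 w - M k w).

Lemma martingale_bounded_rv k : bounded_rv (M k).
Proof. by split => //; exact: (measurable_fun_sub (@S_sub k) (@M_adapted k)). Qed.

Let dM k : bounded_rv (fun w => M k.+1 w - M k w).
Proof. by apply: bounded_rvB; exact: martingale_bounded_rv. Qed.

(** Increments are orthogonal: the cross term 2 M_n (M_{n+1} - M_n) integrates to zero by
    [centered_mul]. *)
Lemma martingale_second_moment n :
  \int[P]_w (M n w ^+ 2) = \int[P]_w (M 0 w ^+ 2)
    + \sum_(i < n) \int[P]_w ((M i.+1 w - M i w) ^+ 2).
Proof.
elim: n => [|n IH]; first by rewrite big_ord0 addr0.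
rewrite big_ord_recr /= addrA -IH.
have bM := martingale_bounded_rv n.
have -> : \int[P]_w (M n.+1 w ^+ 2) = \int[P]_w
    (M n w ^+ 2 + (M n.+1 w - M n w) ^+ 2 + 2 * (M n w * (M n.+1 w - M n w))).
  by apply: eq_Rintegral => w _; ring.
rewrite Rintegral_bounded_rvD; last 2 first.
- by apply: bounded_rvD; exact: bounded_rv_sqr.
- by apply: bounded_rvM; [exact: bounded_rv_cst|exact: bounded_rvM].
rewrite Rintegral_bounded_rvD; [|exact: bounded_rv_sqr..].
rewrite Rintegral_bounded_rvZ; last exact: bounded_rvM.
have [C MC] := M_bounded n.
by rewrite (centered_mul (@S_sub n) (dM n) (@M_centered n) (@M_adapted n) MC) mulr0 addr0.
Qed.

Let mx n w := running_max (fun k => `|M k w|) n.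

Let mx_adapted n : measurable_fun [set: g_sigma_algebraType (S n)] (mx n).
Proof.
elim: n => [|n IH]; first by apply: measurableT_comp => //; exact: M_adapted.
apply: measurable_maxr; last by apply: measurableT_comp => //; exact: M_adapted.
by move=> mT B mB; apply: (S_nd (leqnSn n)); exact: (IH measurableT B mB).
Qed.

Let mx_bounded n : exists C : R, forall w, `|mx n w| <= C.
Proof.
elim: n => [|n [C IH]].
  by have [C MC] := M_bounded 0; exists C => w; rewrite /mx/= normr_id.
have [D MD] := M_bounded n.+1; exists (Num.max C D) => w; rewrite /mx/=.
have IHw := IH w; have MDw := MD w; rewrite /mx in IHw.
by rewrite le_max; case: (leP (running_max _ _) _) => _; rewrite ?normr_id ?IHw ?MDw ?orbT.
Qed.

Lemma bounded_rv_running_max n : bounded_rv (fun w => running_max (fun k => `|M k w|) n).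
Proof.
by split; [exact: (measurable_fun_sub (@S_sub n) (@mx_adapted n))|exact: mx_bounded].
Qed.

Lemma doob_L2 n :
  \int[P]_w (running_max (fun k => `|M k w|) n ^+ 2) <= 4 * \int[P]_w (M n w ^+ 2).
Proof.
(* The sign of M_i, known at time i, satisfies |M_{i+1}| - |M_i| >= e_i (M_{i+1} - M_i). The sum in
   the pathwise inequality is thus bounded below by a martingale transform of mean zero. *)
pose e i w : R := if 0 <= M i w then 1 else -1.
have e_adapted i : measurable_fun [set: g_sigma_algebraType (S i)] (e i).
  apply: measurable_fun_ifT => //.
  by apply: measurable_fun_ler => //; exact: M_adapted.
have e1 i w : `|e i w| = 1.
  by rewrite /e; case: ifP => _; rewrite ?normrN normr1.
have be i : bounded_rv (e i).
  split; first exact: (measurable_fun_sub (@S_sub i) (@e_adapted i)).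
  by exists 1 => w; rewrite e1.
pose X i w := mx i w * e i w * (M i.+1 w - M i w).
have bmx i := bounded_rv_running_max i.
have bX i : bounded_rv (X i) := bounded_rvM (bounded_rvM (bmx i) (be i)) (dM i).
have EX i : \int[P]_w X i w = 0.
  have [C mxC] := mx_bounded i.
  apply: (centered_mul (@S_sub i) (dM i) (@M_centered i) (C := C)).
    exact: measurable_funM.
  by move=> w; rewrite normrM e1 mulr1.
have bM2 := bounded_rv_sqr (martingale_bounded_rv n).
have := @le_Rintegral_bounded_rv _ _ _ P
  (fun w => mx n w ^+ 2 + 4 * \sum_(i < n) X i w) (fun w => 4 * M n w ^+ 2).
have bS : bounded_rv (fun w => \sum_(i < n) X i w).
  exact: (bounded_rv_sum _ (fun i : 'I_n => bX i)).
rewrite Rintegral_bounded_rvD; last 2 first.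
- exact: (bounded_rv_sqr (bmx n)).
- by apply: bounded_rvM => //; exact: bounded_rv_cst.
rewrite !Rintegral_bounded_rvZ//.
rewrite (Rintegral_bounded_rv_sum _ _ (fun i : 'I_n => bX i)).
rewrite big1 ?mulr0 ?addr0; last first.
  by move=> i _; exact: EX.
apply.
- apply: bounded_rvD; first exact: (bounded_rv_sqr (bmx n)).
  by apply: bounded_rvM => //; exact: bounded_rv_cst.
- by apply: bounded_rvM => //; exact: bounded_rv_cst.
move=> w; have := @sqr_running_max_le R (fun k => `|M k w|) n (fun k => normr_ge0 _).
rewrite real_normK ?num_real//; apply: le_trans.
rewrite lerD2l ler_pM2l// ler_sum// => i _; rewrite /X -mulrA ler_wpM2l//.
  by apply: le_trans (le_running_max _ (leq0n i)); exact: normr_ge0.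
have h1 : e i w * M i w = `|M i w|.
  rewrite /e; case: ifPn => h; first by rewrite mul1r ger0_norm.
  by rewrite mulN1r ler0_norm// ltW// ltNge.
rewrite mulrBr h1 lerB//; apply: le_trans (ler_norm _) _.
by rewrite normrM e1 mul1r.
Qed.

End discrete_martingale.

(** * The stopped count and its compensator *)

Section marked_paths.
Context (disp : measure_display) (Omega : measurableType disp) (R : realType).
Context (d : nat) (tau : nat -> Omega -> \bar R) (Z : nat -> Omega -> 'I_d).
Hypothesis mpp : is_marked_point_process tau Z.

Lemma jump_time_gt0 n w : (0 < tau n w)%E.
Proof. by case: mpp. Qed.

Lemma jump_time_nd m n w : (m <= n)%N -> (tau m w <= tau n w)%E.
Proof.
move=> /subnK <-; elim: (n - m)%N => [//|k IH].
by rewrite addSn (le_trans IH)//; case: mpp.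
Qed.

Lemma jump_time_lt m n w : (m < n)%N -> (tau m w < +oo)%E ->
  (tau m w < tau n w)%E.
Proof.
move=> mn fin; apply: lt_le_trans (jump_time_nd w mn).
by case: mpp => _ _ _ _; apply.
Qed.

Lemma jump_time_finE n w : (tau n w < +oo)%E -> tau n w = (fine (tau n w))%:E.
Proof. by move=> fin; rewrite fineK// gt0_fin_numE// jump_time_gt0. Qed.

Lemma stopped_timeE n (t : R) w : 0 <= t ->
  (stopped_time tau n t w)%:E = Order.min t%:E (tau n w).
Proof.
move=> t0; rewrite /stopped_time fineK// minElt; case: ifP => // /negbT.
rewrite -leNgt => h; rewrite gt0_fin_numE ?jump_time_gt0//.
by rewrite (le_lt_trans h)// ltry.
Qed.

Lemma stopped_time_ge0 n (t : R) w : 0 <= t -> 0 <= stopped_time tau n t w.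
Proof.
move=> t0; rewrite -lee_fin stopped_timeE// le_min lee_fin t0/=.
by rewrite ltW// jump_time_gt0.
Qed.

Lemma stopped_time_le n (t : R) w : 0 <= t -> stopped_time tau n t w <= t.
Proof. by move=> t0; rewrite -lee_fin stopped_timeE// ge_min lexx. Qed.

Lemma stopped_time_nd n (s t : R) w : 0 <= s -> s <= t ->
  stopped_time tau n s w <= stopped_time tau n t w.
Proof.
move=> s0 st; rewrite -lee_fin !stopped_timeE ?(le_trans s0 st)//.
by rewrite le_min !ge_min lexx lee_fin st orbT.
Qed.

Lemma stopped_timeB n (s t : R) w : 0 <= s -> s <= t ->
  stopped_time tau n t w - stopped_time tau n s w <= t - s.
Proof.
move=> s0 st; have t0 := le_trans s0 st.
have := stopped_timeE n w s0; have := stopped_timeE n w t0.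
case: (leP t%:E (tau n w)) => tn.
  have sn : (s%:E <= tau n w)%E by rewrite (le_trans _ tn)// lee_fin.
  by rewrite (min_idPl sn) => -[->] [->].
case: (leP s%:E (tau n w)) => sn.
  move=> /[swap] -[->] h; rewrite lerD2r -lee_fin h ltW//.
by move=> h1; rewrite -h1 => -[->]; rewrite subrr subr_ge0.
Qed.

Lemma stopped_time_id n (t : R) w : 0 <= t -> (t%:E <= tau n w)%E ->
  stopped_time tau n t w = t.
Proof. by move=> t0 h; apply: EFin_inj; rewrite stopped_timeE//; exact/min_idPl. Qed.

Lemma jump_countE i (t : R) w : (jump_count tau Z i t w =
  \sum_(0 <= n <oo) ((tau n w <= t%:E)%E && (Z n w == i))%:R%:E)%E.
Proof.
apply: eq_eseriesr => n _; rewrite indicE; congr ((nat_of_bool _)%:R%:E).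
apply/idP/idP; first by rewrite inE => -[-> ->]; rewrite eqxx.
by move=> /andP[h /eqP h']; rewrite inE.
Qed.

Lemma jump_count_ge0 i (t : R) w : (0 <= jump_count tau Z i t w)%E.
Proof. by rewrite jump_countE; apply: nneseries_ge0 => n _ _; rewrite lee_fin ler0n. Qed.

Lemma jump_count_nd i (s t : R) w : s <= t ->
  (jump_count tau Z i s w <= jump_count tau Z i t w)%E.
Proof.
move=> st; rewrite !jump_countE; apply: lee_nneseries => n _.
  by move=> _; rewrite lee_fin ler0n.
rewrite lee_fin ler_nat; case: (leP (tau n w) s%:E) => //= h.
by rewrite (le_trans h)// lee_fin.
Qed.

(* Up to time tau n only the first n.+1 jumps can occur, which makes the stopped
   count a finite sum. *)
Definition stopped_count n (i : 'I_d) (t : R) (w : Omega) : R :=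
  \sum_(k < n.+1) ((tau k w <= t%:E)%E && (Z k w == i))%:R.

Lemma jump_count_stopped n i (t : R) w : 0 <= t ->
  jump_count tau Z i (stopped_time tau n t w) w = (stopped_count n i t w)%:E.
Proof.
move=> t0; rewrite jump_countE (nneseries_split 0 n.+1); last first.
  by move=> k _; rewrite lee_fin ler0n.
rewrite add0n eseries0 ?adde0; last first.
  (* A jump k > n lies strictly after [tau n] if that is finite; otherwise it is itself infinite and
     exceeds the real time t. *)
  move=> k nk _; rewrite stopped_timeE// le_min.
  have [fin|] := ltP (tau n w) +oo%E.
    by rewrite [(tau k w <= tau n w)%E]leNgt (jump_time_lt nk fin) andbF.
  rewrite leye_eq => /eqP nfin.
  have -> : tau k w = +oo%E.
    by apply/eqP; rewrite -leye_eq -nfin jump_time_nd// ltnW.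
  by rewrite leye_eq.
rewrite big_mkord /stopped_count -sumEFin; apply: eq_bigr => k _.
rewrite stopped_timeE// le_min (jump_time_nd w (_ : (k <= n)%N)) ?andbT//.
by rewrite -ltnS.
Qed.

Lemma stopped_count_ge0 n i (t : R) w : 0 <= stopped_count n i t w.
Proof. by apply: sumr_ge0 => k _; rewrite ler0n. Qed.

Lemma stopped_count_le n i (t : R) w : stopped_count n i t w <= n.+1%:R.
Proof.
rewrite -[X in _ <= X%:R]card_ord -sumr_const; apply: ler_sum => k _.
by rewrite lern1 leq_b1.
Qed.

Lemma stopped_count_nd n i (s t : R) w : s <= t ->
  stopped_count n i s w <= stopped_count n i t w.
Proof.
move=> st; apply: ler_sum => k _; rewrite ler_nat.
case: (leP (tau k w) s%:E) => //= h.
by rewrite (le_trans h)// lee_fin.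
Qed.

Lemma stopped_count0 n i w : stopped_count n i 0 w = 0.
Proof.
apply: big1 => k _.
by rewrite leNgt (jump_time_gt0 k w).
Qed.

Lemma measurable_jump_indicator k i (t : R) :
  measurable_fun setT (fun w => ((tau k w <= t%:E)%E && (Z k w == i))%:R : R).
Proof.
have mA : measurable [set w | (tau k w <= t%:E)%E /\ Z k w = i].
  case: mpp => mtau mZ _ _ _; apply: measurableI; last exact: mZ.
  by rewrite -[X in measurable X]setTI; exact: emeasurable_fun_infty_c.
rewrite (_ : (fun w => _) = \1_[set w | (tau k w <= t%:E)%E /\ Z k w = i]).
  exact: measurable_indic.
apply/funext => w; rewrite indicE; congr ((nat_of_bool _)%:R).
apply/idP/idP; first by move=> /andP[h /eqP h']; rewrite inE.
by rewrite inE => -[-> ->]; rewrite eqxx.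
Qed.

Lemma measurable_stopped_count n i (t : R) : measurable_fun setT (stopped_count n i t).
Proof. by apply: measurable_sum => k; exact: measurable_jump_indicator. Qed.

Lemma measurable_jump_count i (t : R) : measurable_fun setT (jump_count tau Z i t).
Proof.
rewrite (_ : jump_count tau Z i t = fun w => (\sum_(0 <= n <oo)
    ((tau n w <= t%:E)%E && (Z n w == i))%:R%:E)%E); last first.
  by apply/funext => w; exact: jump_countE.
apply: ge0_emeasurable_sum => k.
- by move=> w _ _; rewrite lee_fin ler0n.
- by move=> _; apply/measurable_EFinP; exact: measurable_jump_indicator.
Qed.

End marked_paths.

Section compensator.
Context (disp : measure_display) (Omega : measurableType disp) (R : realType).
Context (d : nat) (tau : nat -> Omega -> \bar R) (Z : nat -> Omega -> 'I_d).
Context (mu : 'cV[R]_d) (phi : 'I_d -> 'I_d -> R -> R).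
Hypothesis mpp : is_marked_point_process tau Z.
Hypothesis mu_ge0 : forall i, 0 <= mu i ord0.
Hypothesis phi_ge0 : forall i j (t : R), 0 <= t -> 0 <= phi i j t.
Hypothesis phi_measurable :
  forall i j, measurable_fun (`[0, +oo[ : set R) (phi i j).
Hypothesis phi_integrable : forall i j,
  (\int[lebesgue_measure]_(t in `[0%R, +oo[) (phi i j t)%:E < +oo)%E.

Local Notation leb := (@lebesgue_measure R).
Local Notation K := (kernel_integral phi).

Lemma kernel_integral_ge0 i j : 0 <= K i j.
Proof.
rewrite mxE; apply: Rintegral_ge0 => t /=; rewrite in_itv/= andbT.
exact: phi_ge0.
Qed.

(** The share of the n-th jump in the i-th intensity integrated over [0, u]. The finiteness test
    matters: [fine] sends +oo to 0, which would create a phantom jump at time 0. *)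
Definition jump_impact i j (u : R) n w : R :=
  if (tau n w < +oo)%E && (Z n w == j)
  then cumul (phi i j) (u - fine (tau n w)) else 0.

Lemma jump_impact_ge0 i j (u : R) n w : 0 <= jump_impact i j u n w.
Proof. by rewrite /jump_impact; case: ifP => // _; exact: (cumul_ge0 (@phi_ge0 i j)). Qed.

Lemma jump_impact_le_kernel i j (u : R) n w : jump_impact i j u n w <= K i j.
Proof.
rewrite /jump_impact; case: ifP => // _; last exact: kernel_integral_ge0.
by rewrite mxE; exact: (cumul_le (@phi_ge0 i j) (@phi_measurable i j) (@phi_integrable i j)).
Qed.

Lemma jump_impact0 i j (u : R) n w : (u%:E < tau n w)%E -> jump_impact i j u n w = 0.
Proof.
move=> ut; rewrite /jump_impact; case: ifP => // /andP[fin _].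
apply: (cumul_lt0 (@phi_ge0 i j) (@phi_measurable i j) (@phi_integrable i j)).
by rewrite subr_lt0 -lte_fin -(jump_time_finE mpp fin).
Qed.

Lemma jump_impact_le i j (u : R) n w : jump_impact i j u n w
  <= K i j * ((tau n w <= u%:E)%E && (Z n w == j))%:R.
Proof.
have [h|h] := leP (tau n w) u%:E; last first.
  by rewrite jump_impact0//= mulr0.
have [h'|h'] := eqVneq (Z n w) j; first by rewrite mulr1 jump_impact_le_kernel.
by rewrite /jump_impact (negbTE h') andbF mulr0.
Qed.

Lemma intensityE i (s : R) w : (intensity tau Z mu phi i s w = (mu i ord0)%:E +
  \sum_(j < d) \sum_(0 <= n <oo) (if (tau n w < +oo)%E && (Z n w == j)
    then \int[\d_(fine (tau n w))]_(r in `]0%R, s[) (phi i j (s - r))%:E else 0))%E.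
Proof.
congr (_ + _)%E; apply: eq_bigr => j _.
rewrite ge0_integral_measure_series//; last 2 first.
- move=> r /=; rewrite in_itv/= => /andP[_ rs]; rewrite lee_fin phi_ge0//.
  by rewrite subr_ge0 ltW.
- exact: (measurable_kernel_reflect (@phi_measurable i j)).
apply: eq_eseriesr => n _; case: ifP => // _.
exact: integral_measure_zero.
Qed.

Lemma integral_intensity i (u : R) w : 0 <= u ->
  (\int[leb]_(s in `[0%R, u]) intensity tau Z mu phi i s w =
   (mu i ord0 * u)%:E +
   \sum_(j < d) \sum_(0 <= n <oo) (jump_impact i j u n w)%:E)%E.
Proof.
move=> u0.
pose f j n (s : R) : \bar R := (if (tau n w < +oo)%E && (Z n w == j)
    then \int[\d_(fine (tau n w))]_(r in `]0%R, s[) (phi i j (s - r))%:E else 0)%E.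
have f_ge0 j n s : (0 <= f j n s)%E.
  rewrite /f; case: ifP => // _; apply: integral_ge0 => r /=.
  rewrite in_itv/= => /andP[_ rs].
  by rewrite lee_fin phi_ge0// subr_ge0 ltW.
have mf j n (D : set R) : measurable_fun D (f j n).
  rewrite /f.
  case: (boolP ((tau n w < +oo)%E && (Z n w == j))) => [/andP[fin _]|_]; last first.
    exact: measurable_cst.
  apply: (measurable_dirac_kernel (@phi_measurable i j)).
  by rewrite -lte_fin -(jump_time_finE mpp fin) (jump_time_gt0 mpp).
have mfs j (D : set R) : measurable_fun D (fun s => \sum_(0 <= n <oo) f j n s)%E.
  by apply: ge0_emeasurable_sum => // k _.
have fs_ge0 j s : (0 <= \sum_(0 <= n <oo) f j n s)%E.
  by apply: nneseries_ge0.
rewrite (@eq_integral _ (measurableTypeR R) R leb _ (fun s =>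
    (mu i ord0)%:E + \sum_(j < d) \sum_(0 <= n <oo) f j n s)%E); last first.
  by move=> s _; exact: intensityE.
rewrite ge0_integralD//; last 3 first.
- by move=> s _; rewrite lee_fin.
- by move=> s _; exact: sume_ge0.
- by apply: emeasurable_sum => j; exact: mfs.
congr (_ + _)%E.
  rewrite integral_cst//= lebesgue_measure_itv/= lte_fin EFinM; case: ltP => u0'.
    by rewrite -EFinB subr0.
  by have /eqP -> : u == 0 by rewrite eq_le u0 u0'.
rewrite ge0_integral_sum//; last by move=> j; exact: mfs.
apply: eq_bigr => j _; rewrite integral_nneseries//; last by move=> n; exact: mf.
apply: eq_eseriesr => n _; rewrite /f /jump_impact.
case: (boolP ((tau n w < +oo)%E && (Z n w == j))) => [/andP[fin _]|_]; last exact: integral0.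
rewrite (integral_integral_dirac_kernel (@phi_ge0 i j) (@phi_measurable i j)
  (@phi_integrable i j))//.
by rewrite -lte_fin -(jump_time_finE mpp fin) (jump_time_gt0 mpp).
Qed.

(** A jump at c is counted at time u - s exactly when s <= u - c, so exchanging sum and integral
    produces the kernel integrated over [0, u - c]. The compensator becomes a convolution of the
    kernel with N, the form in which bounds on N can be inserted. *)
Lemma jump_impact_series i j (u : R) w :
  (\sum_(0 <= n <oo) (jump_impact i j u n w)%:E =
   \int[leb]_(s in `[0%R, u]) ((phi i j s)%:E * jump_count tau Z j (u - s) w))%E.
Proof.
have mphi : measurable_fun (`[0, u] : set R) (phi i j).
  apply: measurable_funS (phi_measurable i j) => //.
  by move=> t /=; rewrite !in_itv/= => /andP[->].
transitivity (\int[leb]_(s in `[0%R, u]) \sum_(0 <= n <oo)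
    ((phi i j s)%:E * ((tau n w <= (u - s)%:E)%E && (Z n w == j))%:R%:E))%E; last first.
  apply: eq_integral => s; rewrite inE/= in_itv/= => /andP[s0 _].
  by rewrite jump_countE nneseriesZl.
have ind_meas n : measurable_fun (`[0, u] : set R)
    (fun s => ((tau n w <= (u - s)%:E)%E && (Z n w == j))%:R : R).
  have [fin|] := ltP (tau n w) +oo%E; last first.
    rewrite leye_eq => /eqP ->.
    rewrite (_ : (fun _ => _) = cst 0); first exact: measurable_cst.
    by apply/funext => s; rewrite leye_eq.
  have [_|_] := eqVneq (Z n w) j; last first.
    rewrite (_ : (fun _ => _) = cst 0); first exact: measurable_cst.
    by apply/funext => s; rewrite andbF.
  rewrite (_ : (fun _ => _) = \1_(`]-oo, u - fine (tau n w)])).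
    exact: measurable_indic.
  apply/funext => s; rewrite indicE mem_setE in_itv/= andbT.
  by rewrite {1}(jump_time_finE mpp fin) lee_fin lerBrDr addrC -lerBrDr.
rewrite integral_nneseries//; last 2 first.
- move=> n; apply: emeasurable_funM; first exact/measurable_EFinP.
  by apply/measurable_EFinP; exact: ind_meas.
- move=> n s /=; rewrite in_itv/= => /andP[s0 _].
  by rewrite mule_ge0 ?lee_fin ?phi_ge0.
apply: eq_eseriesr => n _; rewrite /jump_impact.
have [fin|] := ltP (tau n w) +oo%E => /=; last first.
  rewrite leye_eq => /eqP ->.
  by rewrite integral0_eq// => s _; rewrite leye_eq/= mule0.
have [h|_] := eqVneq (Z n w) j; last first.
  by rewrite integral0_eq// => s _; rewrite andbF mule0.
have t0 : 0 < fine (tau n w).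
  by rewrite -lte_fin -(jump_time_finE mpp fin) (jump_time_gt0 mpp).
rewrite -(integral_cumul (@phi_ge0 i j) (@phi_measurable i j) (@phi_integrable i j)).
rewrite integral_mkcond [RHS]integral_mkcond.
apply: eq_integral => s _; rewrite /patch !mem_setE !in_itv/=.
rewrite {2}(jump_time_finE mpp fin) lee_fin andbT.
have -> : (fine (tau n w) <= u - s) = (s <= u - fine (tau n w)).
  by rewrite lerBrDr addrC -lerBrDr.
case: (leP 0 s) => //= s0.
case: (leP s (u - fine (tau n w))) => su.
  by rewrite (le_trans su) ?mule1// gerBl ltW.
by case: ifP; rewrite ?mule0.
Qed.

(** Only the jumps 0 to n can act before [tau n], so a finite real sum replaces the extended
    integral of the intensity; [integral_intensity_stopped] shows that they agree. *)
Definition stopped_compensator n i (t : R) w : R :=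
  mu i ord0 * stopped_time tau n t w +
  \sum_(j < d) \sum_(k < n.+1) jump_impact i j (stopped_time tau n t w) k w.

Lemma integral_intensity_stopped n i (t : R) w : 0 <= t ->
  (\int[leb]_(s in `[0%R, stopped_time tau n t w]) intensity tau Z mu phi i s w
   = (stopped_compensator n i t w)%:E)%E.
Proof.
move=> t0; rewrite integral_intensity; last exact: (stopped_time_ge0 mpp).
rewrite EFinD; congr (_ + _)%E; rewrite -sumEFin; apply: eq_bigr => j _.
rewrite (nneseries_split 0 n.+1); last first.
  by move=> k _; rewrite lee_fin jump_impact_ge0.
rewrite add0n eseries0 ?adde0; first by rewrite big_mkord sumEFin.
move=> k nk _.
have ut : ((stopped_time tau n t w)%:E <= tau n w)%E.
  by rewrite (stopped_timeE mpp)// ge_min lexx orbT.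
rewrite jump_impact0//.
have [fin|nfin] := ltP (tau n w) +oo%E.
  by rewrite (le_lt_trans ut)// (jump_time_lt mpp nk fin).
move: nfin; rewrite leye_eq => /eqP nfin.
by have := jump_time_nd mpp w (ltnW nk); rewrite nfin leye_eq => /eqP ->; rewrite ltry.
Qed.

Lemma compensated_countE n i (t : R) w : 0 <= t ->
  compensated_count tau Z mu phi n i t w
  = (stopped_count tau Z n i t w - stopped_compensator n i t w)%:E.
Proof.
move=> t0; rewrite /compensated_count (jump_count_stopped mpp)//.
by rewrite integral_intensity_stopped// EFinB.
Qed.

Lemma stopped_compensator_ge0 n i (t : R) w : 0 <= t ->
  0 <= stopped_compensator n i t w.
Proof.
move=> t0; rewrite addr_ge0//; first by rewrite mulr_ge0// (stopped_time_ge0 mpp).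
by apply: sumr_ge0 => j _; apply: sumr_ge0 => k _; exact: jump_impact_ge0.
Qed.

Lemma stopped_compensator0 n i w : stopped_compensator n i 0 w = 0.
Proof.
rewrite /stopped_compensator.
have -> : stopped_time tau n 0 w = 0.
  by apply/eqP; rewrite eq_le (stopped_time_ge0 mpp)// (stopped_time_le mpp).
rewrite mulr0 add0r big1// => j _; rewrite big1// => k _.
by rewrite jump_impact0//; exact: (jump_time_gt0 mpp).
Qed.

Lemma stopped_compensator_le n i (t : R) w : 0 <= t ->
  stopped_compensator n i t w <=
  mu i ord0 * t + \sum_(j < d) K i j * stopped_count tau Z n j t w.
Proof.
move=> t0; apply: lerD; first by rewrite ler_wpM2l// (stopped_time_le mpp).
apply: ler_sum => j _; rewrite mulr_sumr; apply: ler_sum => k _.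
apply: le_trans (jump_impact_le _ _ _ _ _) _.
rewrite ler_wpM2l ?kernel_integral_ge0// ler_nat.
have [h|h] := leP (tau k w) (stopped_time tau n t w)%:E => //=.
by rewrite (le_trans h)// lee_fin (stopped_time_le mpp).
Qed.

Lemma stopped_compensator_nd n i (s t : R) w : 0 <= s -> s <= t ->
  stopped_compensator n i s w <= stopped_compensator n i t w.
Proof.
move=> s0 st; have st' := stopped_time_nd mpp n w s0 st.
apply: lerD; first by rewrite ler_wpM2l.
apply: ler_sum => j _; apply: ler_sum => k _; rewrite /jump_impact.
case: ifP => // _.
apply: (cumul_nd (@phi_ge0 i j) (@phi_measurable i j) (@phi_integrable i j)).
by rewrite lerD2r.
Qed.

(* Uniform in w: it rests on the absolute continuity of the integrals of phi and
   on the bound n.+1 on the number of jumps. *)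
Lemma stopped_compensator_unif_continuous n (e : R) : 0 < e ->
  exists2 h : R, 0 < h & forall i (s t : R) w, 0 <= s -> s <= t -> t - s < h ->
    stopped_compensator n i t w - stopped_compensator n i s w <= e.
Proof.
move=> e0.
(* The drift receives one share, and each of the d (n + 1) pairs of a mark and a jump another. *)
pose e1 := e / (1 + d%:R * n.+1%:R).
have e10 : 0 < e1.
  by rewrite divr_gt0// ltr_pwDl// mulr_ge0.
have hP i j : exists h : R, 0 < h /\ forall a b : R, a <= b -> b - a < h ->
    cumul (phi i j) b - cumul (phi i j) a <= e1.
  have [h h0 H] := cumul_unif_continuous (@phi_ge0 i j) (@phi_measurable i j)
    (@phi_integrable i j) e10.
  by exists h; split => // a b ab bah; exact/ltW/H.
have [h hP'] := choice (fun ij => hP ij.1 ij.2).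
pose h1 := \big[Num.min/1]_(ij : 'I_d * 'I_d) h ij.
(* This keeps the increment of the drift below [e1]; adding 1 to mu_i avoids a division by zero. *)
pose h2 := \big[Num.min/1]_(i < d) (e1 / (1 + mu i ord0)).
have mu1 i : 0 < 1 + mu i ord0 by rewrite ltr_pwDl.
exists (Num.min h1 h2).
  rewrite lt_min; apply/andP; split; apply/bigmin_gtP; split=> // i _.
    by have [] := hP' i.
  exact: divr_gt0.
move=> i s t w s0 st; rewrite lt_min => /andP[th1 th2].
have ub := stopped_timeB mpp n w s0 st; have ab := stopped_time_nd mpp n w s0 st.
set a := stopped_time tau n s w in ub ab *; set b := stopped_time tau n t w in ub ab *.
have -> : e = e1 + d%:R * n.+1%:R * e1.
  by rewrite -{1}[e1]mul1r -mulrDl mulrC divfK// gt_eqF// ltr_pwDl// mulr_ge0.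
rewrite /stopped_compensator -/a -/b opprD addrACA; apply: lerD.
  rewrite -mulrBr; have := lt_le_trans th2 (bigmin_le _ i (fun i => e1 / (1 + mu i ord0))).
  rewrite ltr_pdivlMr// => th3.
  have := mu_ge0 i; nra.
rewrite -sumrB.
apply: (@le_trans _ _ (\sum_(j < d) n.+1%:R * e1)); last first.
  by rewrite sumr_const card_ord -[X in X <= _]mulr_natl mulrA.
apply: ler_sum => j _; rewrite -sumrB.
apply: (@le_trans _ _ (\sum_(k < n.+1) e1)); last first.
  by rewrite sumr_const card_ord -[X in X <= _]mulr_natl.
apply: ler_sum => k _; rewrite /jump_impact; case: ifP => _; last by rewrite subrr ltW.
have [_ H] := hP' (i, j); apply: H; first by rewrite lerD2r.
rewrite opprB addrA subrK (le_lt_trans ub)// (lt_le_trans th1)//.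
exact: (bigmin_le _ (i, j) h).
Qed.

End compensator.

(** * Second moment of the stopped martingale *)

(** At most one summand is 1, so the sum is 0 or 1. It will be applied to the jumps of one mark
    inside a grid cell. *)
Lemma sum_bool_le1_sqr (R : realType) (n : nat) (b : 'I_n -> bool) :
  (forall k l, b k -> b l -> k = l) ->
  (\sum_(k < n) (b k)%:R) ^+ 2 = \sum_(k < n) (b k)%:R :> R.
Proof.
move=> b1; have [[k bk]|nb] := pselect (exists k, b k).
  rewrite (bigD1 k)//= bk big1 ?addr0 ?expr1n// => l lk.
  by case: (boolP (b l)) => // bl; rewrite (b1 _ _ bl bk) eqxx in lk.
rewrite big1 ?expr0n// => k _; case: (boolP (b k)) => // bk.
by exfalso; apply: nb; exists k.
Qed.

Section stopped_martingale.
Context (disp : measure_display) (Omega : measurableType disp) (R : realType).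
Context (P : probability Omega R) (d : nat).
Context (tau : nat -> Omega -> \bar R) (Z : nat -> Omega -> 'I_d).
Context (mu : 'cV[R]_d) (phi : 'I_d -> 'I_d -> R -> R).
Hypothesis mu_ge0 : forall i, 0 <= mu i ord0.
Hypothesis phi_ge0 : forall i j (t : R), 0 <= t -> 0 <= phi i j t.
Hypothesis phi_measurable :
  forall i j, measurable_fun (`[0, +oo[ : set R) (phi i j).
Hypothesis hawkes : is_hawkes P tau Z mu phi.
Hypothesis phi_integrable : forall i j,
  (\int[lebesgue_measure]_(t in `[0%R, +oo[) (phi i j t)%:E < +oo)%E.

Let mpp : is_marked_point_process tau Z := hawkes.1.

Local Notation K := (kernel_integral phi).
Local Notation count := (stopped_count tau Z).
Local Notation comp := (stopped_compensator tau Z mu phi).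

Definition stopped_martingale n i (t : R) w : R := count n i t w - comp n i t w.
Local Notation M := stopped_martingale.

(** The generators of [history t] under a name of their own, since [g_sigma_algebraType] takes the
    generating class; [<<s history_gen t >>] is [history t] by definition. *)
Definition history_gen (t : R) : set_system Omega :=
  [set A | exists (i : 'I_d) (s : R), [/\ 0 <= s, s <= t &
     preimage_set_system setT (jump_count tau Z i s) measurable A]].

Lemma history_measurable (t : R) : <<s history_gen t >> `<=` measurable.
Proof.
apply: smallest_sub; first exact: sigma_algebra_measurable.
move=> A [i [s [_ _ [B mB <-]]]].
by apply: (measurable_jump_count mpp).
Qed.

Lemma history_nd (s t : R) : s <= t ->
  <<s history_gen s >> `<=` <<s history_gen t >>.
Proof.
move=> st; apply: sub_sigma_algebra2 => A [i [r [r0 rs h]]].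
by exists i, r; split => //; exact: le_trans st.
Qed.

Lemma stopped_count_bounded n i (t : R) : bounded_rv (count n i t).
Proof.
split; first exact: (measurable_stopped_count mpp).
exists n.+1%:R => w; rewrite ger0_norm; first exact: stopped_count_le.
exact: stopped_count_ge0.
Qed.

Lemma stopped_compensator_bound n i (t : R) : 0 <= t ->
  exists C : R, forall w, 0 <= comp n i t w <= C.
Proof.
move=> t0; exists (mu i ord0 * t + \sum_(j < d) K i j * n.+1%:R) => w.
rewrite (stopped_compensator_ge0 mpp mu_ge0 phi_ge0)//=.
apply: le_trans (stopped_compensator_le mpp mu_ge0 phi_ge0 phi_measurable
  phi_integrable n i w t0) _.
rewrite lerD2l; apply: ler_sum => j _; rewrite ler_wpM2l//; last exact: stopped_count_le.
exact: kernel_integral_ge0.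
Qed.

Lemma stopped_martingaleE n i (t : R) : 0 <= t ->
  M n i t = fine \o compensated_count tau Z mu phi n i t.
Proof.
move=> t0; apply/funext => w /=.
by rewrite (compensated_countE mpp mu_ge0 phi_ge0 phi_measurable phi_integrable n i w t0).
Qed.

Lemma stopped_martingale_adapted n i (t : R) : 0 <= t ->
  measurable_fun [set: g_sigma_algebraType (history_gen t)] (M n i t).
Proof.
move=> t0; rewrite stopped_martingaleE//.
apply: (measurableT_comp (fine_measurable measurableT)).
move=> _ B mB; have [+ _ _] := hawkes.2 n i.
by move=> /(_ t t0); apply; exists B.
Qed.

Lemma stopped_martingale_bounded n i (t : R) : 0 <= t ->
  exists C : R, forall w, `|M n i t w| <= C.
Proof.
move=> t0; have [C compC] := stopped_compensator_bound n i t0.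
exists (n.+1%:R + C) => w; apply: le_trans (ler_normB _ _) _.
have /andP[c0 cC] := compC w.
rewrite lerD//; rewrite ger0_norm//; last exact: stopped_count_ge0.
exact: stopped_count_le.
Qed.

Lemma bounded_rv_stopped_martingale n i (t : R) : 0 <= t -> bounded_rv (M n i t).
Proof.
move=> t0; split; last exact: stopped_martingale_bounded.
apply: (measurable_fun_sub (@history_measurable t)).
exact: stopped_martingale_adapted.
Qed.

Lemma stopped_martingale_centered n i (s t : R) : 0 <= s -> s <= t ->
  centered_on P (history_gen s) (fun w => M n i t w - M n i s w).
Proof.
move=> s0 st A hA; have t0 := le_trans s0 st.
have mA := history_measurable hA.
have [_ _ /(_ s t s0 st)[_ _ /(_ A hA) eqA]] := hawkes.2 n i.
have bMs := bounded_rv_stopped_martingale n i s0.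
have bMt := bounded_rv_stopped_martingale n i t0.
have bA := bounded_rv_indic R mA.
have E r : 0 <= r -> (\int[P]_w (\1_A w * M n i r w))%:E
    = (\int[P]_(w in A) compensated_count tau Z mu phi n i r w)%E.
  move=> r0; rewrite EFin_Rintegral_bounded_rv; last first.
    exact: (bounded_rvM bA (bounded_rv_stopped_martingale n i r0)).
  rewrite [RHS]integral_mkcond; apply: eq_integral => w _.
  rewrite /patch indicE.
  rewrite (compensated_countE mpp mu_ge0 phi_ge0 phi_measurable phi_integrable n i w r0).
  by case: (w \in A); rewrite ?mul1r ?mul0r.
under eq_Rintegral do rewrite mulrBr.
rewrite (Rintegral_bounded_rvB P (bounded_rvM bA bMt) (bounded_rvM bA bMs)).
apply/eqP; rewrite subr_eq0; apply/eqP/EFin_inj.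
exact: (etrans (E t t0) (etrans (esym eqA) (esym (E s s0)))).
Qed.

Lemma stopped_martingale0 n i w : M n i 0 w = 0.
Proof.
rewrite /M (stopped_count0 mpp).
by rewrite (stopped_compensator0 mu mpp phi_ge0 phi_measurable phi_integrable) subrr.
Qed.

Lemma Rintegral_stopped_martingale n i (t : R) : 0 <= t ->
  \int[P]_w M n i t w = 0.
Proof.
move=> t0; have := stopped_martingale_centered n i (lexx 0) t0.
move=> /(_ setT)/(_ (@measurableT _ (g_sigma_algebraType (history_gen 0)))) <-.
by apply: eq_Rintegral => w _; rewrite indicT stopped_martingale0 subr0 mul1r.
Qed.

(** Measurability in w is read off from A = N - M: N is a finite sum of indicators of events, and M
    is adapted by assumption. *)
Lemma bounded_rv_stopped_compensator n i (t : R) : 0 <= t -> bounded_rv (comp n i t).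
Proof.
move=> t0.
rewrite (_ : comp n i t = (fun w => count n i t w - M n i t w)).
  exact: (bounded_rvB (stopped_count_bounded n i t) (bounded_rv_stopped_martingale n i t0)).
apply/funext => w.
by rewrite /stopped_martingale opprB addrC subrK.
Qed.

Lemma Rintegral_stopped_count n i (t : R) : 0 <= t ->
  \int[P]_w count n i t w = \int[P]_w comp n i t w.
Proof.
move=> t0; apply/eqP; rewrite -subr_eq0.
rewrite -(Rintegral_bounded_rvB P (stopped_count_bounded n i t)
  (bounded_rv_stopped_compensator n i t0)).
by rewrite (Rintegral_stopped_martingale n i t0).
Qed.

Lemma Rintegral_stopped_count_le n (t : R) : 0 <= t -> spectral_radius K < 1 ->
  forall i, \int[P]_w count n i t w <= t * lln_limit mu phi i ord0.
Proof.
move=> t0 rho1 i.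
have K0 : forall i j, 0 <= K i j by move=> *; exact: kernel_integral_ge0.
have h j : \int[P]_w count n j t w <=
    mu j ord0 * t + \sum_k K j k * \int[P]_w count n k t w.
  rewrite Rintegral_stopped_count//.
  have bc k : bounded_rv (fun w => K j k * count n k t w).
    by apply: bounded_rvM; [exact: bounded_rv_cst|exact: stopped_count_bounded].
  have bs : bounded_rv (fun w => \sum_(k < d) K j k * count n k t w).
    exact: bounded_rv_sum.
  have bm : bounded_rv (fun w : Omega => mu j ord0 * t) by exact: bounded_rv_cst.
  have le_comp w := stopped_compensator_le mpp mu_ge0 phi_ge0 phi_measurable
    phi_integrable n j w t0.
  apply: le_trans (le_Rintegral_bounded_rv P
    (bounded_rv_stopped_compensator n j t0) (bounded_rvD bm bs) le_comp) _.
  rewrite (Rintegral_bounded_rvD P bm bs) Rintegral_probability_cst lerD2l.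
  rewrite Rintegral_bounded_rv_sum//.
  by apply: ler_sum => k _; rewrite (Rintegral_bounded_rvZ P _ (stopped_count_bounded n k t)).
apply: le_trans (le_invmx_sub K0 rho1 h i) _.
rewrite /lln_limit mxE mulr_sumr; apply: ler_sum => k _.
by rewrite mulrA mulrC.
Qed.

(** * Quadratic variation along a grid *)

Section grid.
Context (n : nat) (T : R).
Hypothesis T_ge0 : 0 <= T.

Definition grid N (k : nat) : R := k%:R * (T / N.+1%:R).

Lemma grid_ge0 N k : 0 <= grid N k.
Proof. by rewrite mulr_ge0// divr_ge0. Qed.

Lemma grid_nd N k l : (k <= l)%N -> grid N k <= grid N l.
Proof. by move=> kl; rewrite ler_wpM2r ?divr_ge0// ler_nat. Qed.

Lemma gridS N k : grid N k.+1 - grid N k = T / N.+1%:R.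
Proof. by rewrite /grid -natr1 mulrDl mul1r addrC addKr. Qed.

Lemma grid0 N : grid N 0 = 0.
Proof. by rewrite /grid mul0r. Qed.

Lemma grid_last N : grid N N.+1 = T.
Proof. by rewrite /grid mulrC divfK. Qed.

Definition grid_variation i N w : R :=
  \sum_(k < N.+1) (count n i (grid N k.+1) w - count n i (grid N k) w) ^+ 2.

Lemma stopped_countB i (s t : R) w : s <= t ->
  count n i t w - count n i s w
  = \sum_(k < n.+1) [&& (s%:E < tau k w)%E, (tau k w <= t%:E)%E & Z k w == i]%:R.
Proof.
move=> st; rewrite /stopped_count -sumrB; apply: eq_bigr => k _.
have [ts|ts] := leP (tau k w) s%:E => /=; last by rewrite subr0.
by rewrite (le_trans ts) ?lee_fin// subrr.
Qed.

(** Once the mesh is at most the smallest gap between consecutive jumps, a cell, being open on the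
    left, contains at most one of the first n + 1 jumps. Squared increments then equal increments,
    and the sum telescopes. The mesh needed depends on w, so expectations pass to the limit by
    dominated convergence. *)
Lemma grid_variation_eventually i w :
  \forall N \near \oo, grid_variation i N w = count n i T w.
Proof.
(* A gap that ends at an infinite jump time never separates two jumps of the grid; the value 1 just
   keeps the minimum positive. *)
pose gap m : R := if (tau m.+1 w < +oo)%E then fine (tau m.+1 w) - fine (tau m w) else 1.
pose delta := \big[Num.min/1]_(m < n.+1) gap m.
have delta0 : 0 < delta.
  apply/bigmin_gtP; split => // m _; rewrite /gap; case: ifP => // fin.
  have finm : (tau m w < +oo)%E.
    by rewrite (le_lt_trans _ fin)// (jump_time_nd mpp).
  have := jump_time_lt mpp (ltnSn m) finm.
  by rewrite {1}(jump_time_finE mpp finm) (jump_time_finE mpp fin) lte_fin subr_gt0.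
exists (Num.truncn (T / delta)) => // N /= dN.
have mesh : T / N.+1%:R <= delta.
  rewrite ler_pdivrMr// mulrC -ler_pdivrMr//.
  apply: le_trans (ltW (truncnS_gt _)) _.
  by rewrite ler_nat.
have one k (a b : 'I_n.+1) :
    [&& ((grid N k)%:E < tau a w)%E, (tau a w <= (grid N k.+1)%:E)%E & Z a w == i] ->
    [&& ((grid N k)%:E < tau b w)%E, (tau b w <= (grid N k.+1)%:E)%E & Z b w == i] ->
    (a < b)%N -> False.
  move=> /and3P[a1 a2 _] /and3P[b1 b2 _] ab.
  have finb : (tau b w < +oo)%E by rewrite (le_lt_trans b2)// ltry.
  have fina : (tau a w < +oo)%E by rewrite (le_lt_trans a2)// ltry.
  have leab := jump_time_nd mpp w ab.
  have finS : (tau a.+1 w < +oo)%E by rewrite (le_lt_trans leab).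
  have := bigmin_le 1 a gap; rewrite -/delta /gap finS.
  move: leab a1 b2; rewrite (jump_time_finE mpp finb) (jump_time_finE mpp fina).
  rewrite (jump_time_finE mpp finS) !lee_fin !lte_fin/= => h1 h2 h3 h4.
  by have := mesh; rewrite -(gridS N k); lra.
rewrite /grid_variation.
transitivity (\sum_(k < N.+1) (count n i (grid N k.+1) w - count n i (grid N k) w)).
  apply: eq_bigr => k _; rewrite stopped_countB ?grid_nd//.
  apply: sum_bool_le1_sqr => a b ha hb; apply/val_inj => /=.
  by case: (ltngtP a b) => // h; exfalso; [exact: (one k a b)|exact: (one k b a)].
have := @telescope_sumr _ 0%N N.+1 (fun k => count n i (grid N k) w) isT.
by rewrite big_mkord => ->; rewrite grid_last grid0 (stopped_count0 mpp) subr0.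
Qed.

Lemma grid_variation_bounded i N : bounded_rv (grid_variation i N).
Proof.
apply: (bounded_rv_sum _ (fun k : 'I_N.+1 => _)) => k; apply: bounded_rv_sqr.
by apply: bounded_rvB; exact: stopped_count_bounded.
Qed.

(** Each increment lies in [0, n + 1] and the increments add up to at most n + 1. This is the
    dominating constant for the limit. *)
Lemma grid_variation_le i N w : 0 <= grid_variation i N w <= n.+1%:R ^+ 2.
Proof.
rewrite sumr_ge0/=; last by move=> k _; exact: sqr_ge0.
apply: (@le_trans _ _ (\sum_(k < N.+1)
    n.+1%:R * (count n i (grid N k.+1) w - count n i (grid N k) w))).
  apply: ler_sum => k _; rewrite expr2 ler_wpM2r//.
    by rewrite subr_ge0 stopped_count_nd// grid_nd.
  by rewrite lerBlDr (le_trans (stopped_count_le _ _ _ _ _ _))// lerDl stopped_count_ge0.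
rewrite -mulr_sumr expr2 ler_wpM2l//.
have := @telescope_sumr _ 0%N N.+1 (fun k => count n i (grid N k) w) isT.
rewrite big_mkord => ->; rewrite grid_last grid0 (stopped_count0 mpp) subr0.
exact: stopped_count_le.
Qed.

Lemma Rintegral_grid_variation_cvg i :
  \int[P]_w grid_variation i N w @[N --> \oo] --> \int[P]_w count n i T w.
Proof.
have := @dominated_convergence _ _ R P setT measurableT
  (fun N w => (grid_variation i N w)%:E) (fun w => (count n i T w)%:E)
  (fun=> (n.+1%:R ^+ 2)%:E).
case.
- by move=> N; apply/measurable_EFinP; have [] := grid_variation_bounded i N.
- by apply/measurable_EFinP; exact: (measurable_stopped_count mpp).
- apply: aeW => w _; apply: cvg_near_cst.
  by apply: filterS (grid_variation_eventually i w) => N ->.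
- exact: (bounded_rv_integrable P (bounded_rv_cst Omega (n.+1%:R ^+ 2 : R))).
- apply: aeW => w N _; rewrite /= lee_fin.
  by have /andP[v0 vn] := grid_variation_le i N w; rewrite ger0_norm.
move=> _ _ cv.
have : (\int[P]_w grid_variation i N w)%:E @[N --> \oo]
    --> (\int[P]_w count n i T w)%:E.
  rewrite (EFin_Rintegral_bounded_rv P (stopped_count_bounded n i T)).
  apply: cvg_trans cv; apply: near_eq_cvg; apply: nearW => N /=.
  by rewrite (EFin_Rintegral_bounded_rv P (grid_variation_bounded i N)).
by move=> /fine_cvgP[].
Qed.

(** N and A both increase, so the cross term of (dN - dA)^2 is nonpositive. With dA <= e in each
    cell, the (dA)^2 add up to at most e A_T <= e C. The mesh tends to 0 first, then e. *)
Lemma stopped_martingale_second_moment i :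
  \int[P]_w (M n i T w ^+ 2) <= \int[P]_w count n i T w.
Proof.
have [C compC] := stopped_compensator_bound n i T_ge0.
suff main e : 0 < e -> \int[P]_w (M n i T w ^+ 2)
    <= \int[P]_w count n i T w + e * C.
  have C0 : 0 <= C.
    have [w] := probability_inhabited P; have /andP[c0 cC] := compC w.
    exact: le_trans cC.
  apply/ler_addgt0Pr => e e0; have C1 : 0 < C + 1 by rewrite ltr_pwDr.
  apply: le_trans (main (e / (C + 1)) (divr_gt0 e0 C1)) _.
  by rewrite lerD2l mulrAC ler_pdivrMr// ler_pM2l// lerDl.
move=> e0.
have [h h0 hP] := stopped_compensator_unif_continuous mpp mu_ge0 phi_ge0
  phi_measurable phi_integrable n e0.
have bound N : T / N.+1%:R < h -> \int[P]_w (M n i T w ^+ 2)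
    <= \int[P]_w grid_variation i N w + e * C.
  move=> Nh.
  have := @martingale_second_moment _ _ _ P (history_gen \o grid N)
    (fun k => M n i (grid N k)).
  move=> /(_ (fun k => @history_measurable (grid N k))).
  move=> /(_ (fun k => @stopped_martingale_adapted n i _ (grid_ge0 N k))).
  move=> /(_ (fun k => @stopped_martingale_bounded n i _ (grid_ge0 N k))).
  move=> /(_ (fun k => @stopped_martingale_centered n i _ _ (grid_ge0 N k)
    (grid_nd N (leqnSn k)))).
  move=> /(_ N.+1); rewrite grid_last grid0.
  under [X in _ = X + _ -> _]eq_Rintegral do rewrite stopped_martingale0 expr0n/=.
  rewrite Rintegral_probability_cst add0r => ->.
  have bM k := bounded_rv_stopped_martingale n i (grid_ge0 N k).
  have bc k := bounded_rv_stopped_compensator n i (grid_ge0 N k).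
  rewrite -Rintegral_bounded_rv_sum; last first.
    by move=> k; apply: bounded_rv_sqr; exact: bounded_rvB.
  rewrite -[e * C](Rintegral_probability_cst P) -Rintegral_bounded_rvD; last 2 first.
  - exact: grid_variation_bounded.
  - exact: bounded_rv_cst.
  apply: le_Rintegral_bounded_rv.
  - apply: bounded_rv_sum => k; apply: bounded_rv_sqr; exact: bounded_rvB.
  - by apply: bounded_rvD; [exact: grid_variation_bounded|exact: bounded_rv_cst].
  move=> w; apply: (@le_trans _ _ (grid_variation i N w
      + e * \sum_(k < N.+1) (comp n i (grid N k.+1) w - comp n i (grid N k) w))).
    rewrite /grid_variation mulr_sumr -big_split/=; apply: ler_sum => k _.
    have := stopped_count_nd tau Z n i w (grid_nd N (leqnSn k)).
    have := stopped_compensator_nd mpp mu_ge0 phi_ge0 phi_measurable phi_integrable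
      n i w (grid_ge0 N k) (grid_nd N (leqnSn k)).
    have := hP i _ _ w (grid_ge0 N k) (grid_nd N (leqnSn k)).
    rewrite gridS => /(_ Nh); rewrite /stopped_martingale.
    set a := comp _ _ _ _; set b := comp _ _ _ _.
    set a' := count _ _ _ _; set b' := count _ _ _ _.
    by nra.
  rewrite lerD2l ler_pM2l//.
  have := @telescope_sumr _ 0%N N.+1 (fun k => comp n i (grid N k) w) isT.
  rewrite big_mkord => ->; rewrite grid_last grid0.
  rewrite (stopped_compensator0 mu mpp phi_ge0 phi_measurable phi_integrable) subr0.
  by have /andP[] := compC w.
have cvg_bound : \int[P]_w grid_variation i N w + e * C @[N --> \oo]
    --> \int[P]_w count n i T w + e * C.
  by apply: cvgD; [exact: Rintegral_grid_variation_cvg|exact: cvg_cst].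
rewrite -(cvg_lim (@Rhausdorff R) cvg_bound).
apply: limr_ge; first by apply/cvg_ex; eexists; exact: cvg_bound.
exists (Num.truncn (T / h)) => // N /= hN.
apply: bound; rewrite ltr_pdivrMr// mulrC -ltr_pdivrMr//.
apply: lt_le_trans (truncnS_gt _) _.
by rewrite ler_nat.
Qed.

Lemma stopped_martingale_doob i N :
  \int[P]_w (running_max (fun k => `|M n i (grid N k) w|) N.+1 ^+ 2)
  <= 4 * \int[P]_w count n i T w.
Proof.
have := @doob_L2 _ _ _ P (history_gen \o grid N) (fun k => M n i (grid N k)).
move=> /(_ (fun k => @history_measurable (grid N k))).
move=> /(_ (fun k l kl => @history_nd _ _ (grid_nd N kl))).
move=> /(_ (fun k => @stopped_martingale_adapted n i _ (grid_ge0 N k))).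
move=> /(_ (fun k => @stopped_martingale_bounded n i _ (grid_ge0 N k))).
move=> /(_ (fun k => @stopped_martingale_centered n i _ _ (grid_ge0 N k)
  (grid_nd N (leqnSn k)))).
move=> /(_ N.+1); rewrite grid_last => /le_trans; apply.
by rewrite ler_pM2l// stopped_martingale_second_moment.
Qed.

Lemma bounded_rv_grid_max i N :
  bounded_rv (fun w => running_max (fun k => `|M n i (grid N k) w|) N.+1).
Proof.
have := @bounded_rv_running_max _ _ _ (history_gen \o grid N)
  (fun k => M n i (grid N k)).
move=> /(_ (fun k => @history_measurable (grid N k))).
move=> /(_ (fun k l kl => @history_nd _ _ (grid_nd N kl))).
move=> /(_ (fun k => @stopped_martingale_adapted n i _ (grid_ge0 N k))).
move=> /(_ (fun k => @stopped_martingale_bounded n i _ (grid_ge0 N k))).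
exact.
Qed.

End grid.
End stopped_martingale.

(** * Pathwise deviation bound *)

(** N may jump inside a cell, but it stays between its two grid values while A moves by at most e;
    so a bound on N - A at grid times extends to all times. *)
Lemma ler_norm_subr_monotone (R : realType) (c0 c1 c2 a0 a1 a2 e G : R) :
  c0 <= c1 -> c1 <= c2 -> a1 - a0 <= e -> a2 - a1 <= e ->
  `|c0 - a0| <= G -> `|c2 - a2| <= G -> `|c1 - a1| <= G + e.
Proof.
move=> c01 c12 a01 a12; rewrite !ler_norml => /andP[h0 _] /andP[_ h2].
by apply/andP; split; lra.
Qed.

Section pathwise_bound.
Context (disp : measure_display) (Omega : measurableType disp) (R : realType).
Context (d : nat) (tau : nat -> Omega -> \bar R) (Z : nat -> Omega -> 'I_d).
Context (mu : 'cV[R]_d) (phi : 'I_d -> 'I_d -> R -> R).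
Hypothesis mpp : is_marked_point_process tau Z.
Hypothesis mu_ge0 : forall i, 0 <= mu i ord0.
Hypothesis phi_ge0 : forall i j (t : R), 0 <= t -> 0 <= phi i j t.
Hypothesis phi_measurable :
  forall i j, measurable_fun (`[0, +oo[ : set R) (phi i j).
Hypothesis phi_integrable : forall i j,
  (\int[lebesgue_measure]_(t in `[0%R, +oo[) (phi i j t)%:E < +oo)%E.
Hypothesis rho_lt1 : spectral_radius (kernel_integral phi) < 1.

Local Notation leb := (@lebesgue_measure R).
Local Notation K := (kernel_integral phi).
Local Notation B := (invmx (1%:M - kernel_integral phi)).
Local Notation count := (stopped_count tau Z).
Local Notation comp := (stopped_compensator tau Z mu phi).
Local Notation M := (stopped_martingale tau Z mu phi).
Local Notation m i := (lln_limit mu phi i ord0).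

Let K_ge0 i j : 0 <= K i j.
Proof. exact: kernel_integral_ge0. Qed.

Lemma lln_limit_ge0 i : 0 <= m i.
Proof.
rewrite mxE; apply: sumr_ge0 => j _; rewrite mulr_ge0//.
exact: invmx_sub_ge0.
Qed.

(** The fixed-point equation behind the limit: replacing N_s by s m in the compensator yields t (mu
    + K m) = t m to leading order, so the linear terms cancel. *)
Lemma lln_limitE i : m i = mu i ord0 + \sum_j K i j * m j.
Proof.
have : (1%:M - K) *m lln_limit mu phi = mu by rewrite mulKVmx// unitmx_sub.
move=> /matrixP /(_ i ord0); rewrite mulmxBl mul1mx !mxE => <-.
by rewrite subrK.
Qed.

Section before_jump_time.
Context (n : nat) (T : R) (w : Omega).
Hypothesis T_lt : (T%:E <= tau n w)%E.

Lemma jump_count_before j (t : R) : 0 <= t -> t <= T ->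
  jump_count tau Z j t w = (count n j t w)%:E.
Proof.
move=> t0 tT; rewrite -(jump_count_stopped mpp n j w t0).
by rewrite (stopped_time_id mpp)// (le_trans _ T_lt)// lee_fin.
Qed.

Lemma stopped_compensator_before i (t : R) : 0 <= t -> t <= T ->
  ((comp n i t w)%:E = (mu i ord0 * t)%:E + \sum_(j < d)
    \int[leb]_(s in `[0%R, t]) (phi i j s * count n j (t - s) w)%:E)%E.
Proof.
move=> t0 tT.
rewrite -(integral_intensity_stopped mpp mu_ge0 phi_ge0 phi_measurable
  phi_integrable n i w t0).
rewrite (stopped_time_id mpp t0); last by rewrite (le_trans _ T_lt)// lee_fin.
rewrite (integral_intensity mpp mu_ge0 phi_ge0 phi_measurable phi_integrable i w t0).
congr (_ + _)%E; apply: eq_bigr => j _.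
rewrite (jump_impact_series mpp phi_ge0 phi_measurable phi_integrable i j t w).
apply: eq_integral => s; rewrite inE/= in_itv/= => /andP[s0 st].
rewrite jump_count_before ?EFinM// ?subr_ge0//.
by rewrite (le_trans _ tT)// gerBl.
Qed.

Lemma measurable_kernel_count i j (t : R) (D : set R) : D `<=` `[0, t] ->
  measurable D -> measurable_fun D (fun s => (phi i j s * count n j (t - s) w)%:E).
Proof.
move=> Dt mD; apply/measurable_EFinP; apply: measurable_funM.
  apply: measurable_funS (phi_measurable i j) => //.
  by move=> s /Dt /=; rewrite !in_itv/= => /andP[->].
apply: measurable_funTS; apply: nonincreasing_measurable => // r s rs.
by apply: stopped_count_nd; rewrite lerB.
Qed.

Section deviation.
Context (X : 'I_d -> R).
Hypothesis dev_le : forall j t, 0 <= t -> t <= T -> `|count n j t w - m j * t| <= X j.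

Lemma convolution_le i j (t : R) : 0 <= t -> t <= T ->
  (\int[leb]_(s in `[0%R, t]) (phi i j s * count n j (t - s) w)%:E
   <= (K i j * (m j * t + X j))%:E)%E.
Proof.
move=> t0 tT; have X0 : 0 <= X j by apply: le_trans (dev_le j t0 tT).
have m0 := lln_limit_ge0 j.
have c0 : 0 <= m j * t + X j by rewrite addr_ge0// mulr_ge0.
apply: (@le_trans _ _ (\int[leb]_(s in `[0%R, t]) (phi i j s * (m j * t + X j))%:E)%E).
  apply: ge0_le_integral => //.
  - move=> s /=; rewrite in_itv/= => /andP[s0 _].
    by rewrite lee_fin mulr_ge0 ?phi_ge0 ?stopped_count_ge0.
  - exact: measurable_kernel_count.
  - apply/measurable_EFinP; apply: measurable_funM => //.
    apply: measurable_funS (phi_measurable i j) => //.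
    by move=> s /=; rewrite !in_itv/= => /andP[->].
  - move=> s /=; rewrite in_itv/= => /andP[s0 st].
    rewrite lee_fin ler_wpM2l ?phi_ge0//.
    have st0 : 0 <= t - s by rewrite subr_ge0.
    have stT : t - s <= T by rewrite (le_trans _ tT)// gerBl.
    have := dev_le j st0 stT; rewrite ler_norml => /andP[_].
    by nra.
rewrite (integral_kernel_cst (@phi_ge0 i j) (@phi_measurable i j) (@phi_integrable i j))//.
rewrite lee_fin ler_wpM2r// mxE.
exact: (cumul_le (@phi_ge0 i j) (@phi_measurable i j) (@phi_integrable i j)).
Qed.

(** Only lags s <= S are kept. They carry all but e of the kernel mass, and there N_{t-s} >= m (t -
    S) - X. The losses are e t from the tail of the kernel and S K from the shift in time. *)
Lemma convolution_ge i j (e S t : R) : 0 <= t -> t <= T -> 0 <= e -> 0 <= S ->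
  K i j - e <= cumul (phi i j) S ->
  ((m j * (t * K i j - e * t - S * K i j) - K i j * X j)%:E
   <= \int[leb]_(s in `[0%R, t]) (phi i j s * count n j (t - s) w)%:E)%E.
Proof.
move=> t0 tT e0 S0 KS; have X0 : 0 <= X j by apply: le_trans (dev_le j t0 tT).
have m0 := lln_limit_ge0 j; have k0 := K_ge0 i j.
have I0 : (0 <= \int[leb]_(s in `[0%R, t]) (phi i j s * count n j (t - s) w)%:E)%E.
  apply: integral_ge0 => s /=; rewrite in_itv/= => /andP[s0 _].
  by rewrite lee_fin mulr_ge0 ?phi_ge0 ?stopped_count_ge0.
(* For t <= S the left-hand side is nonpositive. *)
have [tS|St] := leP t S.
  apply: le_trans I0; rewrite lee_fin subr_le0.
  apply: (@le_trans _ _ 0); last by rewrite mulr_ge0.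
  rewrite mulr_ge0_le0//.
  by have := mulr_ge0 e0 t0; have := ler_wpM2r k0 tS; lra.
(* Truncation at 0 makes the constant integrand nonnegative, and it remains a lower bound because N
   >= 0. *)
pose c := Num.max 0 (m j * (t - S) - X j).
have c0 : 0 <= c by rewrite le_max lexx.
have cle : cumul (phi i j) S <= K i j.
  by rewrite mxE; exact: (cumul_le (@phi_ge0 i j) (@phi_measurable i j) (@phi_integrable i j)).
have cu0 : 0 <= cumul (phi i j) S := cumul_ge0 (@phi_ge0 i j) S.
apply: (@le_trans _ _ (cumul (phi i j) S * c)%:E).
  rewrite lee_fin.
  have h1 : cumul (phi i j) S * (m j * (t - S) - X j) <= cumul (phi i j) S * c.
    by rewrite ler_wpM2l// le_max lexx orbT.
  apply: le_trans h1.
  have h2 : (K i j - e) * (m j * (t - S)) <= cumul (phi i j) S * (m j * (t - S)).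
    by rewrite ler_wpM2r// mulr_ge0// subr_ge0 ltW.
  have h3 : cumul (phi i j) S * X j <= K i j * X j by rewrite ler_wpM2r.
  have h4 : 0 <= m j * (e * S) by rewrite mulr_ge0// mulr_ge0.
  by nra.
rewrite -(integral_kernel_cst (@phi_ge0 i j) (@phi_measurable i j) (@phi_integrable i j))//.
apply: (@le_trans _ _ (\int[leb]_(s in `[0%R, S]) (phi i j s * count n j (t - s) w)%:E)%E).
  apply: ge0_le_integral => //.
  - move=> s /=; rewrite in_itv/= => /andP[s0 _].
    by rewrite lee_fin mulr_ge0 ?phi_ge0.
  - apply/measurable_EFinP; apply: measurable_funM => //.
    apply: measurable_funS (phi_measurable i j) => //.
    by move=> s /=; rewrite !in_itv/= => /andP[->].
  - apply: measurable_kernel_count => // s /=; rewrite !in_itv/= => /andP[-> sS].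
    by rewrite (le_trans sS)// ltW.
  - move=> s /=; rewrite in_itv/= => /andP[s0 sS].
    rewrite lee_fin ler_wpM2l ?phi_ge0// ge_max stopped_count_ge0/=.
    have st0 : 0 <= t - s by rewrite subr_ge0 (le_trans sS)// ltW.
    have stT : t - s <= T by rewrite (le_trans _ tT)// gerBl.
    have := dev_le j st0 stT; rewrite ler_norml => /andP[+ _].
    have : m j * (t - S) <= m j * (t - s) by rewrite ler_wpM2l// lerB.
    lra.
apply: ge0_subset_integral => //.
- exact: measurable_kernel_count.
- move=> s /=; rewrite in_itv/= => /andP[s0 _].
  by rewrite lee_fin mulr_ge0 ?phi_ge0 ?stopped_count_ge0.
- by move=> s /=; rewrite !in_itv/= => /andP[-> sS]; rewrite (le_trans sS)// ltW.
Qed.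

Lemma deviation_step i (e : R) (S : 'I_d -> R) (G t : R) :
  0 <= t -> t <= T -> 0 <= e -> (forall j, 0 <= S j) ->
  (forall j, K i j - e <= cumul (phi i j) (S j)) ->
  `|M n i t w| <= G ->
  `|count n i t w - m i * t|
    <= G + \sum_j m j * (e * t + S j * K i j) + \sum_j K i j * X j.
Proof.
move=> t0 tT e0 S0 KS; rewrite /stopped_martingale ler_norml => /andP[Gl Gu].
have D0 : 0 <= \sum_j m j * (e * t + S j * K i j).
  apply: sumr_ge0 => j _; have := lln_limit_ge0 j.
  by move=> m0; rewrite mulr_ge0// addr_ge0// mulr_ge0.
have compu : comp n i t w <= m i * t + \sum_j K i j * X j.
  rewrite -lee_fin (stopped_compensator_before i t0 tT).
  rewrite lln_limitE mulrDl -addrA EFinD leeD2l// mulr_suml -big_split/= -sumEFin.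
  apply: lee_sum => j _; apply: le_trans (convolution_le i j t0 tT) _.
  by rewrite lee_fin mulrDr mulrA.
have compl : m i * t - \sum_j m j * (e * t + S j * K i j) - \sum_j K i j * X j
    <= comp n i t w.
  rewrite -lee_fin (stopped_compensator_before i t0 tT).
  rewrite {1}lln_limitE mulrDl -!addrA EFinD leeD2l// mulr_suml -!sumrN.
  rewrite -!big_split/= -sumEFin.
  apply: lee_sum => j _; apply: le_trans (convolution_ge t0 tT e0 (S0 j) (KS j)).
  by rewrite lee_fin; lra.
by rewrite ler_norml; apply/andP; split; lra.
Qed.

End deviation.

(** The stopped count is at most n + 1, so the supremum X of the deviations over [0, T] is a genuine
    real number and the inequality of [deviation_step], taken at all times, can be inverted. *)
Lemma deviation_le (e : R) (S : 'I_d -> 'I_d -> R) (G : 'I_d -> R) :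
  0 <= T -> 0 <= e -> (forall i j, 0 <= S i j) ->
  (forall i j, K i j - e <= cumul (phi i j) (S i j)) ->
  (forall i t, 0 <= t -> t <= T -> `|M n i t w| <= G i) ->
  forall i t, 0 <= t -> t <= T -> `|count n i t w - m i * t|
    <= \sum_j B i j * (G j + \sum_k m k * (e * T + S j k * K j k)).
Proof.
move=> T0 e0 S0 KS MG.
pose A j := [set `|count n j t w - m j * t| | t in `[0, T]].
pose X j := sup (A j).
have AX j : has_ubound (A j).
  exists (n.+1%:R + m j * T) => _ [t /= /[!in_itv]/= /andP[t0 tT] <-].
  apply: le_trans (ler_normB _ _) _; apply: lerD.
    by rewrite ger0_norm; [exact: stopped_count_le|exact: stopped_count_ge0].
  have m0 := lln_limit_ge0 j.
  by rewrite ger0_norm ?mulr_ge0// ler_wpM2l.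
have dev j t : 0 <= t -> t <= T -> `|count n j t w - m j * t| <= X j.
  move=> t0 tT; apply: ub_le_sup => //; exists t => //=.
  by rewrite in_itv/= t0.
have XX i : X i <= (G i + \sum_k m k * (e * T + S i k * K i k)) + \sum_j K i j * X j.
  apply: ge_sup.
    by exists `|count n i 0 w - m i * 0|, 0 => //=; rewrite in_itv/= lexx.
  move=> _ [t /= /[!in_itv]/= /andP[t0 tT] <-].
  apply: le_trans (deviation_step dev t0 tT e0 (S0 i) (KS i) (MG i t t0 tT)) _.
  rewrite lerD2r lerD2l; apply: ler_sum => k _.
  have m0 := lln_limit_ge0 k.
  by rewrite ler_wpM2l// lerD2r ler_wpM2l.
move=> i t t0 tT; apply: le_trans (dev i t t0 tT) _.
exact: (le_invmx_sub K_ge0 rho_lt1 XX).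
Qed.

End before_jump_time.

(** The compensator moves by at most 1 within a cell of this grid; the additive 1 disappears after
    division by T. *)
Lemma stopped_martingale_grid n (T h : R) N w : 0 <= T ->
  (forall i (s t : R) w, 0 <= s -> s <= t -> t - s < h ->
    comp n i t w - comp n i s w <= 1) ->
  T / N.+1%:R < h ->
  forall i t, 0 <= t -> t <= T -> `|M n i t w| <=
    running_max (fun k => `|M n i (grid T N k) w|) N.+1 + 1.
Proof.
move=> T0 hP Nh i t t0 tT.
have maxP k : (k <= N.+1)%N ->
    `|M n i (grid T N k) w| <= running_max (fun k => `|M n i (grid T N k) w|) N.+1.
  exact: (le_running_max (fun k => `|M n i (grid T N k) w|)).
(* The final time is treated apart: rounding down would give it the cell index N + 1, outside the
   grid. *)
move: tT; rewrite le_eqVlt => /orP[/eqP ->|tT].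
  by rewrite -{1}(grid_last T N) (le_trans (maxP _ (leqnn _)))// lerDl.
pose delta := T / N.+1%:R.
have T1 : 0 < T by exact: le_lt_trans tT.
have delta0 : 0 < delta by rewrite divr_gt0.
pose k := Num.truncn (t / delta).
have /andP[kt tk] : k%:R <= t / delta < k.+1%:R.
  by apply: truncn_itv; rewrite divr_ge0// ltW.
have gk : grid T N k <= t by rewrite -ler_pdivlMr.
have gk1 : t <= grid T N k.+1 by rewrite -ler_pdivrMr// ltW.
have kN : (k < N.+1)%N.
  rewrite -(ltr_nat R); apply: le_lt_trans kt _.
  by rewrite ltr_pdivrMr// /delta mulrC divfK.
have d1 : t - grid T N k < h.
  by rewrite (le_lt_trans _ Nh)// -(gridS T N k) lerD2r.
have d2 : grid T N k.+1 - t < h.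
  by rewrite (le_lt_trans _ Nh)// -(gridS T N k) lerD2l lerN2.
apply: (ler_norm_subr_monotone (stopped_count_nd tau Z n i w gk)
  (stopped_count_nd tau Z n i w gk1) (hP i _ _ w (grid_ge0 T0 N k) gk d1)
  (hP i _ _ w t0 gk1 d2) (maxP k (ltnW kN)) (maxP k.+1 kN)).
Qed.

End pathwise_bound.

(** * Measurability of the error *)

Section euclidean_norm.
Context (R : realType) (d : nat).

Lemma enorm2_EFin (x : 'I_d -> R) :
  enorm2 (fun i => (x i)%:E) = (Num.sqrt (\sum_(i < d) x i ^+ 2))%:E.
Proof.
rewrite /enorm2 (eq_bigr (fun i => (x i ^+ 2)%:E)); last first.
  by move=> i _; rewrite /= powR_mulrn// real_normK ?num_real.
rewrite sumEFin poweR_EFin powR12_sqrt//.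
by apply: sumr_ge0 => i _; exact: sqr_ge0.
Qed.

Lemma enorm2_ge_entry (x : 'I_d -> \bar R) i : (`|x i| <= enorm2 x)%E.
Proof.
have -> : (`|x i| = (`|x i| `^ 2) `^ 2^-1)%E by rewrite -poweRrM divff// poweRe1.
apply: gt0_ler_poweR.
- by rewrite invr_ge0.
- by rewrite in_itv/= poweR_ge0 leey.
- rewrite in_itv/= leey andbT; apply: sume_ge0 => j _; exact: poweR_ge0.
rewrite (bigD1 i)//= leeDl//; apply: sume_ge0 => j _; exact: poweR_ge0.
Qed.

Lemma enorm2Z (c : R) (x : 'I_d -> \bar R) : 0 <= c ->
  enorm2 (fun i => c%:E * x i)%E = (c%:E * enorm2 x)%E.
Proof.
move=> c0; have cE : (0 <= c%:E)%E by rewrite lee_fin.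
rewrite /enorm2 (eq_bigr (fun i => (c%:E `^ 2 * `|x i| `^ 2)%E)); last first.
  by move=> i _; rewrite abseM gee0_abs// poweRM.
rewrite -ge0_sume_distrr; last by move=> i _; exact: poweR_ge0.
rewrite poweRM ?poweR_ge0//; last by apply: sume_ge0 => i _; exact: poweR_ge0.
by rewrite -poweRrM divff// poweRe1.
Qed.

Lemma enorm2_le_sum (x : 'I_d -> R) :
  (enorm2 (fun i => (x i)%:E) <= (\sum_(i < d) `|x i|)%:E)%E.
Proof.
have s0 : 0 <= \sum_(i < d) `|x i| by apply: sumr_ge0.
rewrite enorm2_EFin lee_fin -[leRHS](ger0_norm s0) -sqrtr_sqr ler_wsqrtr//.
rewrite {1}expr2 mulr_suml; apply: ler_sum => i _.
rewrite -[x i ^+ 2]real_normK ?num_real// expr2 ler_wpM2l//.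
by rewrite (bigD1 i)//= lerDl sumr_ge0.
Qed.

Lemma measurable_enorm2 (disp : measure_display) (Omega : measurableType disp)
    (x : 'I_d -> Omega -> \bar R) : (forall i, measurable_fun setT (x i)) ->
  measurable_fun setT (fun w => enorm2 (x ^~ w)).
Proof.
move=> mx; apply: (measurableT_comp (measurable_poweR _)).
apply: emeasurable_sum => i; apply: (measurableT_comp (measurable_poweR _)).
exact: measurableT_comp.
Qed.

Lemma enorm2_affine_continuous (a m : 'I_d -> R) :
  continuous (fun v : R => Num.sqrt (\sum_(i < d) (a i - v * m i) ^+ 2)).
Proof.
move=> v; apply: continuous_comp; last exact: sqrt_continuous.
apply: cvg_sumr => i; rewrite expr2; under eq_cvg do rewrite expr2.
have c : a i - v0 * m i @[v0 --> v] --> a i - v * m i.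
  apply: cvgB; first exact: cvg_cst.
  by apply: cvgM; [exact: cvg_id|exact: cvg_cst].
exact: cvgM.
Qed.

End euclidean_norm.

Section lln_error_measurable.
Context (disp : measure_display) (Omega : measurableType disp) (R : realType).
Context (d : nat) (tau : nat -> Omega -> \bar R) (Z : nat -> Omega -> 'I_d).
Context (mu : 'cV[R]_d) (phi : 'I_d -> 'I_d -> R -> R).
Hypothesis mpp : is_marked_point_process tau Z.

Local Notation m i := (lln_limit mu phi i ord0).
Local Notation count := (stopped_count tau Z).

Lemma sum_stopped_count n (t : R) w : (tau n w <= t%:E)%E ->
  \sum_(i < d) count n i t w = n.+1%:R.
Proof.
move=> nt; rewrite /stopped_count exchange_big/=.
rewrite -[X in _ = X%:R]card_ord -sumr_const; apply: eq_bigr => k _.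
have kt : (tau k w <= t%:E)%E.
  by rewrite (le_trans _ nt)// (jump_time_nd mpp)// -ltnS.
rewrite kt (bigD1 (Z k w))//= eqxx big1 ?addr0// => i iZ.
by rewrite eq_sym (negbTE iZ).
Qed.

Lemma stopped_count_le_jump_count n i (t : R) w : 0 <= t ->
  ((count n i t w)%:E <= jump_count tau Z i t w)%E.
Proof.
move=> t0; rewrite -(jump_count_stopped mpp n i w t0).
by apply: jump_count_nd; exact: (stopped_time_le mpp).
Qed.

(** If all components were finite, their sum S would dominate the number n + 1 of jumps seen by time
    t for every n, which fails for n the integer part of S. *)
Lemma jump_count_explosion (t : R) w : 0 <= t -> (forall n, (tau n w <= t%:E)%E) ->
  exists i, jump_count tau Z i t w = +oo%E.
Proof.
move=> t0 nt; apply: contrapT => nex.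
have fin i : jump_count tau Z i t w = (fine (jump_count tau Z i t w))%:E.
  rewrite fineK// ge0_fin_numE ?jump_count_ge0// ltNge leye_eq.
  by apply/negP => /eqP h; apply: nex; exists i.
pose S := \sum_(i < d) fine (jump_count tau Z i t w).
have := sum_stopped_count (nt (Num.truncn S)).
have : \sum_(i < d) count (Num.truncn S) i t w <= S.
  apply: ler_sum => i _; rewrite -lee_fin -fin.
  exact: stopped_count_le_jump_count.
move=> /[swap] ->.
by rewrite leNgt truncnS_gt.
Qed.

Definition lln_error_at (T v : R) w : \bar R := enorm2 (fun i : 'I_d =>
  ((T^-1)%:E * jump_count tau Z i (T * v) w - (v * m i)%:E)%E).

Lemma measurable_lln_error_at T v : measurable_fun setT (lln_error_at T v).
Proof.
apply: measurable_enorm2 => i; apply: emeasurable_funB => //.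
apply: emeasurable_funM => //.
exact: (measurable_jump_count mpp).
Qed.

Lemma lln_error_at_explosion (T v : R) w : 0 < T -> 0 <= v -> v <= 1 ->
  (forall n, (tau n w <= (T * v)%:E)%E) -> lln_error_at T 1 w = +oo%E.
Proof.
move=> T0 v0 v1 nt; have [i hi] := jump_count_explosion (mulr_ge0 (ltW T0) v0) nt.
have hi1 : jump_count tau Z i (T * 1) w = +oo%E.
  apply/eqP; rewrite -leye_eq -hi; apply: jump_count_nd.
  by rewrite ler_pM2l.
apply/eqP; rewrite -leye_eq; apply: le_trans (enorm2_ge_entry _ i).
by rewrite hi1 gt0_muley ?lte_fin ?invr_gt0.
Qed.

(** An enumeration of the rationals of [0, 1] that reduces the supremum to a countable one. The
    default is 1, a point that must occur anyway: right-continuity gives nothing at v = 1, and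
    explosions are detected there. *)
Definition rational_point (n : nat) : R :=
  if unpickle n is Some q then (if 0 <= (ratr q : R) <= 1 then ratr q else 1) else 1.

Lemma rational_point01 n : 0 <= rational_point n <= 1.
Proof.
rewrite /rational_point; case: (unpickle n) => [q|]; last by rewrite ler01 lexx.
by case: ifP => //; rewrite ler01 lexx.
Qed.

Lemma rational_pointE (q : rat) : 0 <= (ratr q : R) <= 1 ->
  rational_point (pickle q) = ratr q.
Proof. by move=> q01; rewrite /rational_point pickleK q01. Qed.

Lemma rational_point1 : rational_point (pickle (1 : rat)) = 1.
Proof. by rewrite rational_pointE rmorph1// ler01 lexx. Qed.

(* Right-continuity of v |-> lln_error_at T v w, together with the fact that an
   explosion before time T makes lln_error_at T 1 w infinite. *)
Lemma lln_error_at_le_sup (T v : R) w : 0 < T -> 0 <= v -> v <= 1 ->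
  (lln_error_at T v w
   <= ereal_sup (range (fun n => lln_error_at T (rational_point n) w)))%E.
Proof.
move=> T0 v0; rewrite le_eqVlt => /orP[/eqP ->|v1].
  by rewrite -rational_point1; apply: ereal_sup_ubound; exists (pickle (1 : rat)).
have Tv0 : 0 <= T * v by rewrite mulr_ge0// ltW.
have [[n0 hn0]|nex] := pselect (exists n, ((T * v)%:E < tau n w)%E); last first.
  have h1 : lln_error_at T 1 w = +oo%E.
    apply: (lln_error_at_explosion T0 v0 (ltW v1)) => n.
    by rewrite leNgt; apply/negP => h; apply: nex; exists n.
  apply: le_trans (leey _) _; rewrite -h1 -rational_point1.
  by apply: ereal_sup_ubound; exists (pickle (1 : rat)).
(* [n] is the first jump after time T v, so by minimality every earlier jump has already
   occurred. *)
have [n hn nmin] := ex_minnP (ex_intro (fun n => ((T * v)%:E < tau n w)%E) n0 hn0).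
(* The count does not change on [v, v1'[: the bound is the rescaled time of the next jump, cut at
   1. *)
pose v1' := if (tau n w < +oo)%E then Num.min 1 (fine (tau n w) / T) else 1.
have vv1' : v < v1'.
  rewrite /v1'; case: ifP => // fin; rewrite lt_min v1 ltr_pdivlMr// mulrC.
  by rewrite -lte_fin -(jump_time_finE mpp fin).
have v1'1 : v1' <= 1 by rewrite /v1'; case: ifP => // _; rewrite ge_min lexx.
have before v' : v' < v1' -> ((T * v')%:E < tau n w)%E.
  rewrite /v1'; case: ifP => [fin|/negbT].
    rewrite lt_min => /andP[_]; rewrite ltr_pdivlMr// mulrC.
    by rewrite -lte_fin -(jump_time_finE mpp fin).
  by rewrite -leNgt leye_eq => /eqP -> _; rewrite ltry.
have cst i v' : v <= v' -> v' < v1' ->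
    jump_count tau Z i (T * v') w = (count n i (T * v) w)%:E.
  move=> vv' v'1; rewrite -(jump_count_stopped mpp n i w Tv0).
  rewrite (stopped_time_id mpp Tv0) ?(ltW hn)//.
  rewrite !jump_countE; apply: eq_eseriesr => k _.
  congr ((nat_of_bool (_ && _))%:R%:E).
  have [nk|kn] := leqP n k.
    have nk' := jump_time_nd mpp w nk.
    by rewrite !leNgt (lt_le_trans hn nk') (lt_le_trans (before _ v'1) nk').
  have kv : (tau k w <= (T * v)%:E)%E.
    by rewrite leNgt; apply/negP => /nmin; rewrite leqNgt kn.
  by rewrite kv (le_trans kv)// lee_fin ler_pM2l.
pose f (x : R) := Num.sqrt (\sum_(i < d) (T^-1 * count n i (T * v) w - x * m i) ^+ 2).
have fE v' : v <= v' -> v' < v1' -> lln_error_at T v' w = (f v')%:E.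
  move=> vv' v'1; rewrite /f -enorm2_EFin; congr enorm2; apply/funext => i.
  by rewrite cst.
apply/lee_addgt0Pr => e e0.
have := @enorm2_affine_continuous R d (fun i => T^-1 * count n i (T * v) w) (fun i => m i) v.
move=> /cvgrPdist_lt /(_ e e0) /nbhs_ballP[r /= r0 hr].
have vr : v < Num.min v1' (v + r) by rewrite lt_min vv1' ltrDl.
have [q] := rat_in_itvoo vr; rewrite in_itv/= lt_min => /and3P[vq qv1 qr].
have q01 : 0 <= (ratr q : R) <= 1.
  by rewrite (le_trans v0 (ltW vq)) (le_trans (ltW qv1)).
have fq : `|f v - f (ratr q)| < e.
  by apply: hr; rewrite /ball/= ltr_distlC; apply/andP; split; lra.
apply: (@le_trans _ _ (lln_error_at T (ratr q) w + e%:E)%E).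
  rewrite !fE// ?(ltW vq)// -EFinD lee_fin.
  by move: fq; rewrite ltr_norml => /andP[_]; lra.
rewrite -(rational_pointE q01) leeD2r//.
by apply: ereal_sup_ubound; exists (pickle q).
Qed.

Lemma lln_errorE (T : R) w : 0 < T -> lln_error tau Z mu phi T w
  = ereal_sup (range (fun n => lln_error_at T (rational_point n) w)).
Proof.
move=> T0; apply/eqP; rewrite eq_le; apply/andP; split.
  apply: ub_ereal_sup => _ [v /= /[!in_itv]/= /andP[v0 v1] <-].
  exact: lln_error_at_le_sup.
apply: le_ereal_sup => _ [n _ <-]; exists (rational_point n) => //=.
by rewrite in_itv/= rational_point01.
Qed.

Lemma measurable_lln_error (T : R) : 0 < T ->
  measurable_fun setT (lln_error tau Z mu phi T).
Proof.
move=> T0.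
rewrite (_ : lln_error tau Z mu phi T = fun w =>
    esups (fun n => lln_error_at T (rational_point n) w) 0).
  apply: (measurable_fun_esups (f := fun n => lln_error_at T (rational_point n))).
  by move=> n; exact: measurable_lln_error_at.
apply/funext => w; rewrite lln_errorE// /esups; congr ereal_sup.
by apply/seteqP; split => _ [n _ <-]; exists n.
Qed.

Lemma lln_error_at_le_lln_error (T v : R) w : 0 <= v <= 1 ->
  (lln_error_at T v w <= lln_error tau Z mu phi T w)%E.
Proof. by move=> v01; apply: ereal_sup_ubound; exists v => //=; rewrite in_itv. Qed.

Lemma lln_error_ge0 (T : R) w : (0 <= lln_error tau Z mu phi T w)%E.
Proof.
apply: le_trans (lln_error_at_le_lln_error T w (v := 0) _); first exact: poweR_ge0.
by rewrite lexx ler01.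
Qed.

(** T times the error at T is the supremum of |N_s - s m| over s <= T, which grows with T. The point
    v at scale S corresponds to S v / T at scale T. *)
Lemma lln_error_scale (S T : R) w : 0 < S -> S <= T ->
  (lln_error tau Z mu phi S w <= (T / S)%:E * lln_error tau Z mu phi T w)%E.
Proof.
move=> S0 ST; have T0 := lt_le_trans S0 ST.
apply: ub_ereal_sup => _ [v /= /[!in_itv]/= /andP[v0 v1] <-].
have v' : 0 <= S * v / T <= 1.
  rewrite divr_ge0 ?mulr_ge0 ?(ltW S0) ?(ltW T0)//= ler_pdivrMr// mul1r.
  by rewrite (le_trans _ ST)// ger_pMr.
have TS0 : 0 < T / S by rewrite divr_gt0.
apply: (@le_trans _ _ ((T / S)%:E * lln_error_at T (S * v / T) w)%E); last first.
  by rewrite lee_pmul2l//; exact: lln_error_at_le_lln_error.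
rewrite /lln_error_at -enorm2Z ?(ltW TS0)//.
have -> : T * (S * v / T) = S * v by rewrite mulrC divfK// gt_eqF.
rewrite le_eqVlt; apply/orP; left; apply/eqP; congr enorm2.
apply/funext => i; have := jump_count_ge0 tau Z i (S * v) w.
case: (jump_count tau Z i (S * v) w) => [r _|_|//].
- congr EFin => /=; field.
  by rewrite !gt_eqF.
- by rewrite !gt0_muley ?lte_fin ?invr_gt0//= gt0_muley ?lte_fin.
Qed.

End lln_error_measurable.

(** * The law of large numbers *)

Lemma sqr_sum_le (R : realType) (d : nat) (a : 'I_d -> R) :
  (\sum_j a j) ^+ 2 <= d%:R * \sum_j a j ^+ 2.
Proof.
set S := \sum_j a j ^+ 2.
have h : \sum_(i < d) \sum_(j < d) (a i ^+ 2 + a j ^+ 2) = 2 * (d%:R * S).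
  under eq_bigr do rewrite big_split/= sumr_const card_ord.
  by rewrite big_split/= sumr_const card_ord sumrMnl -/S mulr_natl mulr2n mulr_natl.
rewrite -(ler_pM2l (_ : 0 < 2))// -h expr2 mulr_suml mulr_sumr.
apply: ler_sum => i _; rewrite !mulr_sumr.
by apply: ler_sum => j _; have := sqr_ge0 (a i - a j); nra.
Qed.

Lemma ge0_ereal_cvg0 (R : realType) (T : Type) (F : set_system T) (FF : Filter F)
    (f : T -> \bar R) :
  (forall x, (0 <= f x)%E) ->
  (forall e : R, 0 < e -> \forall x \near F, (f x <= e%:E)%E) ->
  f @ F --> 0%E.
Proof.
move=> f0 fe; apply/fine_cvgP; split.
  near=> x; rewrite ge0_fin_numE//.
  by apply: (@le_lt_trans _ _ 1%:E); [near: x; exact: fe|exact: ltry].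
apply/cvgrPdist_le => e e0; near=> x.
rewrite sub0r normrN/= ger0_norm ?fine_ge0//.
have fx : (f x <= e%:E)%E by near: x; exact: fe.
by rewrite -lee_fin fineK// ge0_fin_numE// (le_lt_trans fx)// ltry.
Unshelve. all: by end_near. Qed.

(** The positive part of x - e. The deterministic part of the error is only known to be e plus
    O(1/T), so it is this quantity, and not the error, whose second moment decays like 1/T. *)
Definition excess (R : realType) (e : R) (x : \bar R) : \bar R := Order.max (x - e%:E)%E 0%E.

Lemma poweR2_le_excess (R : realType) (e : R) (x : \bar R) : (0 <= x)%E -> 0 < e ->
  (x `^ 2 <= (2 * e ^+ 2)%:E + 2%:E * (excess e x `^ 2))%E.
Proof.
move=> + e0; case: x => [r r0|_|//]; last first.
  by rewrite /excess addye// maxye poweRyr// gt0_muley ?lte_fin// addey// leey.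
rewrite lee_fin in r0.
have -> : excess e r%:E = (Num.max (r - e) 0)%:E.
  by rewrite /excess -EFinB EFin_max.
rewrite !poweR_EFin !powR_mulrn ?le_max ?lexx ?orbT//.
rewrite -EFinM -EFinD lee_fin.
have h1 : r <= e + Num.max (r - e) 0.
  by rewrite -lerBlDl le_max lexx.
have h2 : 0 <= Num.max (r - e) 0 by rewrite le_max lexx orbT.
set y := Num.max _ _ in h1 h2 *.
have h3 : r ^+ 2 <= (e + y) ^+ 2.
  by rewrite ler_sqr ?nnegrE// addr_ge0// ltW.
by have := sqr_ge0 (e - y); lra.
Qed.

Section lln_estimate.
Context (disp : measure_display) (Omega : measurableType disp) (R : realType).
Context (P : probability Omega R) (d : nat).
Context (tau : nat -> Omega -> \bar R) (Z : nat -> Omega -> 'I_d).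
Context (mu : 'cV[R]_d) (phi : 'I_d -> 'I_d -> R -> R).
Hypothesis mu_ge0 : forall i, 0 <= mu i ord0.
Hypothesis phi_ge0 : forall i j (t : R), 0 <= t -> 0 <= phi i j t.
Hypothesis phi_measurable :
  forall i j, measurable_fun (`[0, +oo[ : set R) (phi i j).
Hypothesis hawkes : is_hawkes P tau Z mu phi.
Hypothesis phi_integrable : forall i j,
  (\int[lebesgue_measure]_(t in `[0%R, +oo[) (phi i j t)%:E < +oo)%E.
Hypothesis rho_lt1 : spectral_radius (kernel_integral phi) < 1.

Let mpp : is_marked_point_process tau Z := hawkes.1.

Local Notation K := (kernel_integral phi).
Local Notation B := (invmx (1%:M - kernel_integral phi)).
Local Notation count := (stopped_count tau Z).
Local Notation M := (stopped_martingale tau Z mu phi).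
Local Notation m i := (lln_limit mu phi i ord0).

Let K_ge0 i j : 0 <= K i j.
Proof. exact: kernel_integral_ge0. Qed.

Let B_ge0 i j : 0 <= B i j.
Proof. exact: invmx_sub_ge0. Qed.

Let m_ge0 i : 0 <= m i.
Proof. exact: (lln_limit_ge0 mu_ge0 phi_ge0 rho_lt1). Qed.

Let E_count_le n (t : R) i : 0 <= t -> \int[P]_w count n i t w <= t * m i.
Proof.
move=> t0.
exact: (Rintegral_stopped_count_le mu_ge0 phi_ge0 phi_measurable hawkes
  phi_integrable n t0 rho_lt1).
Qed.

Let measurable_before n (t : R) : measurable [set w | (t%:E < tau n w)%E].
Proof.
case: mpp => mtau _ _ _ _; rewrite -[X in measurable X]setTI.
exact: emeasurable_fun_o_infty.
Qed.

Let measurable_after n (t : R) : measurable [set w | (tau n w <= t%:E)%E].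
Proof.
case: mpp => mtau _ _ _ _; rewrite -[X in measurable X]setTI.
exact: emeasurable_fun_infty_c.
Qed.

(** Markov's inequality: on this event all components together have made the first n + 1 jumps,
    while their expected number is at most t times the sum of the m_i. Letting n grow excludes
    explosion. *)
Lemma probability_jump_time_le n (t : R) : 0 <= t ->
  (P [set w | (tau n w <= t%:E)%E] <= (t * (\sum_i m i) / n.+1%:R)%:E)%E.
Proof.
move=> t0; set A := [set w | _].
have mA : measurable A by exact: measurable_after.
have bA : bounded_rv (\1_A : Omega -> R) by exact: bounded_rv_indic.
have <- : (\int[P]_w (\1_A w)%:E)%E = P A by rewrite integral_indic// setIT.
rewrite -EFin_Rintegral_bounded_rv// lee_fin ler_pdivlMr// mulrC.
rewrite -(Rintegral_bounded_rvZ P _ bA) mulr_sumr.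
have bc (i : 'I_d) : bounded_rv (count n i t) by exact: (stopped_count_bounded hawkes).
apply: (@le_trans _ _ (\int[P]_w \sum_i count n i t w)); last first.
  rewrite (Rintegral_bounded_rv_sum P _ bc); apply: ler_sum => i _.
  exact: E_count_le.
apply: le_Rintegral_bounded_rv.
- by apply: bounded_rvM => //; exact: bounded_rv_cst.
- exact: bounded_rv_sum.
move=> w; have [wA|wA] := pselect (A w).
  by rewrite (sum_stopped_count mpp wA) indicE mem_set// mulr1.
rewrite indicE memNset// mulr0; apply: sumr_ge0 => i _.
exact: stopped_count_ge0.
Qed.

(** The events {t < tau n} increase to a set of probability one, so bounds that are uniform in n
    pass to the whole space by monotone convergence. *)
Lemma le_integral_before (t : R) (f : Omega -> \bar R) (c : \bar R) : 0 <= t ->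
  measurable_fun setT f -> (forall w, (0 <= f w)%E) ->
  (forall n, (\int[P]_(w in [set w | (t%:E < tau n w)%E]) f w <= c)%E) ->
  (\int[P]_w f w <= c)%E.
Proof.
move=> t0 mf f0 fc; pose A n := [set w | (t%:E < tau n w)%E].
have mA n : measurable (A n) by exact: measurable_before.
pose N := ~` \bigcup_n A n.
have mN : measurable N by apply: measurableC; exact: bigcup_measurable.
have PN : P N = 0%E.
  apply/eqP; rewrite eq_le measure_ge0 andbT; apply/lee_addgt0Pr => e e0.
  rewrite add0e.
  pose n := Num.truncn (t * (\sum_i m i) / e).
  apply: (@le_trans _ _ (P [set w | (tau n w <= t%:E)%E])).
    apply: le_measure; [exact/mem_set|exact/mem_set/measurable_after|].
    by move=> w /= Nw; rewrite leNgt; apply/negP => h; apply: Nw; exists n.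
  apply: le_trans (probability_jump_time_le n t0) _.
  by rewrite lee_fin ler_pdivrMr// [leRHS]mulrC -ler_pdivrMr// ltW// truncnS_gt.
rewrite (ge0_negligible_integral mN)//.
have -> : setT `\` N = \bigcup_n A n by rewrite setTD setCK.
have cv : (\int[P]_(w in A n) f w @[n --> \oo] --> \int[P]_(w in \bigcup_n A n) f w)%E.
  apply: ge0_nondecreasing_set_cvg_integral => //.
  - move=> k l kl; apply/subsetPset => w /= /lt_le_trans; apply.
    exact: (jump_time_nd mpp).
  - by move=> i; exact: measurable_funTS.
apply: (cvge_le _ cv); exact: nearW.
Qed.

Let gmax n (T : R) N (j : 'I_d) w : R :=
  running_max (fun k => `|M n j (grid T N k) w|) N.+1.

Let bounded_gmax n (T : R) N j : 0 <= T -> bounded_rv (gmax n T N j).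
Proof.
move=> T0.
exact: (bounded_rv_grid_max mu_ge0 phi_ge0 phi_measurable hawkes phi_integrable n T0 j N).
Qed.

Let gmax_ge0 n (T : R) N j w : 0 <= gmax n T N j w.
Proof. exact: le_trans (normr_ge0 _) (le_running_max _ (leq0n _)). Qed.

(** The random part of the pathwise bound, summed over i because the Euclidean norm is estimated by
    the sum of the absolute values. *)
Let noise n (T : R) N w : R := \sum_i \sum_j B i j * gmax n T N j w.

Let bounded_noise n (T : R) N : 0 <= T -> bounded_rv (noise n T N).
Proof.
move=> T0; apply: bounded_rv_sum => i; apply: bounded_rv_sum => j.
by apply: bounded_rvM; [exact: bounded_rv_cst|exact: bounded_gmax].
Qed.

Let noise_ge0 n (T : R) N w : 0 <= noise n T N w.
Proof.
by apply: sumr_ge0 => i _; apply: sumr_ge0 => j _; rewrite mulr_ge0.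
Qed.

(** The factors come from the total mass of the inverse, from Cauchy-Schwarz (d), from Doob's
    inequality (4) and from E N_T <= T m. *)
Let noise_constant := (\sum_i \sum_j B i j) ^+ 2 * d%:R * (4 * \sum_j m j).

Let noise_second_moment n (T : R) N : 0 <= T ->
  \int[P]_w (noise n T N w ^+ 2) <= noise_constant * T.
Proof.
move=> T0; pose b := \sum_i \sum_j B i j.
have b0 : 0 <= b by apply: sumr_ge0 => i _; exact: sumr_ge0.
have bg j := bounded_gmax n N j T0.
have bg2 j := bounded_rv_sqr (bg j).
have bs : bounded_rv (fun w => \sum_j gmax n T N j w ^+ 2) by exact: bounded_rv_sum.
apply: (@le_trans _ _ (\int[P]_w ((b ^+ 2 * d%:R) * \sum_j gmax n T N j w ^+ 2))).
  apply: le_Rintegral_bounded_rv.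
  - by apply: bounded_rv_sqr; exact: bounded_noise.
  - by apply: bounded_rvM => //; exact: bounded_rv_cst.
  move=> w; rewrite -mulrA; apply: le_trans (_ : (b * \sum_j gmax n T N j w) ^+ 2 <= _).
    rewrite ler_sqr ?nnegrE//; last by rewrite mulr_ge0// sumr_ge0.
    rewrite /b mulr_suml; apply: ler_sum => i _; rewrite mulr_suml.
    apply: ler_sum => j _; rewrite ler_wpM2l// (bigD1 j)//= lerDl.
    by rewrite sumr_ge0.
  by rewrite exprMn ler_wpM2l ?sqr_ge0// sqr_sum_le.
rewrite (Rintegral_bounded_rvZ P _ bs) /noise_constant -/b -!mulrA ler_wpM2l ?sqr_ge0//.
rewrite ler_wpM2l// (Rintegral_bounded_rv_sum P _ bg2) mulr_suml mulr_sumr.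
rewrite ler_wpM2l//; apply: ler_sum => j _.
have := stopped_martingale_doob mu_ge0 phi_ge0 phi_measurable hawkes phi_integrable n T0 j N.
move=> /le_trans; apply; rewrite ler_pM2l// mulrC.
exact: E_count_le.
Qed.

(** The order of quantifiers is the point: D is fixed before n and T, whereas the grid size may
    depend on both because the second-moment bound for [noise] ignores it. *)
Lemma lln_error_before (e : R) : 0 < e -> exists2 D : R, 0 <= D &
  forall n (T : R), 0 < T -> exists N, forall w, (T%:E < tau n w)%E ->
    (lln_error tau Z mu phi T w <= (e + T^-1 * (noise n T N w + D))%:E)%E.
Proof.
move=> e0.
pose b := \sum_i \sum_j B i j * \sum_k m k.
have b0 : 0 <= b.
  by apply: sumr_ge0 => i _; apply: sumr_ge0 => j _; rewrite mulr_ge0// sumr_ge0.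
(* The kernel tails cost [e1] m_k T each, which the inverse amplifies to e1 b T in total; this
   choice keeps it below e T. *)
pose e1 := e / (1 + b).
have b1 : 0 < 1 + b by rewrite ltr_pwDl.
have e10 : 0 < e1 by rewrite divr_gt0.
have eb : e1 * b <= e by rewrite mulrAC ler_pdivrMr// ler_pM2l// lerDr.
have hS ij : exists s, 0 <= s /\ K ij.1 ij.2 - e1 <= cumul (phi ij.1 ij.2) s.
  have [s s0 hs] := cumul_cvg (@phi_ge0 ij.1 ij.2) (@phi_measurable ij.1 ij.2)
    (@phi_integrable ij.1 ij.2) e10.
  by exists s; rewrite mxE.
have [S' hS'] := choice hS; pose S i j := S' (i, j).
have S0 i j : 0 <= S i j by have [] := hS' (i, j).
have KS i j : K i j - e1 <= cumul (phi i j) (S i j) by have [] := hS' (i, j).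
(* What does not grow with T: the 1 from the motion inside a grid cell and the cost S K of the time
   shift. *)
pose D := \sum_i \sum_j B i j * (1 + \sum_k m k * (S j k * K j k)).
have D0 : 0 <= D.
  apply: sumr_ge0 => i _; apply: sumr_ge0 => j _; rewrite mulr_ge0// addr_ge0//.
  by apply: sumr_ge0 => k _; rewrite mulr_ge0// mulr_ge0.
exists D => // n T T0; have T0' := ltW T0.
have [h h0 hP] := stopped_compensator_unif_continuous mpp mu_ge0 phi_ge0
  phi_measurable phi_integrable n ltr01.
pose N := Num.truncn (T / h); exists N => w Tw; have Tw' := ltW Tw.
have Nh : T / N.+1%:R < h.
  by rewrite ltr_pdivrMr// mulrC -ltr_pdivrMr// truncnS_gt.
have MG i t : 0 <= t -> t <= T -> `|M n i t w| <= gmax n T N i w + 1.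
  exact: (stopped_martingale_grid w T0' hP Nh).
have dev := deviation_le mpp mu_ge0 phi_ge0 phi_measurable phi_integrable rho_lt1
  Tw' T0' (ltW e10) S0 KS MG.
have total : \sum_i \sum_j B i j * (gmax n T N j w + 1
    + \sum_k m k * (e1 * T + S j k * K j k)) = noise n T N w + D + e1 * b * T.
  rewrite /noise /D /b mulr_sumr mulr_suml -!big_split/=; apply: eq_bigr => i _.
  rewrite mulr_sumr mulr_suml -!big_split/=; apply: eq_bigr => j _.
  under eq_bigr do rewrite mulrDr.
  rewrite big_split/= -mulr_suml; ring.
apply: ub_ereal_sup => _ [v /= /[!in_itv]/= /andP[v0 v1] <-].
have Tv0 : 0 <= T * v by rewrite mulr_ge0.
have TvT : T * v <= T by rewrite ger_pMr.
have -> : (fun i => (T^-1)%:E * jump_count tau Z i (T * v) w - (v * m i)%:E)%E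
    = (fun i => (T^-1 * (count n i (T * v) w - m i * (T * v)))%:E).
  apply/funext => i; rewrite (jump_count_before mpp Tw' i Tv0 TvT).
  congr EFin => /=; field; by rewrite gt_eqF.
apply: le_trans (enorm2_le_sum _) _; rewrite lee_fin.
have T'0 : 0 < T^-1 by rewrite invr_gt0.
apply: (@le_trans _ _ (T^-1 * (noise n T N w + D + e1 * b * T))).
  rewrite -total mulr_sumr; apply: ler_sum => i _.
  by rewrite normrM gtr0_norm// ler_pM2l// dev.
rewrite mulrDr addrC lerD2r mulrCA mulVf ?gt_eqF// mulr1//.
Qed.

(** Before [tau n] the excess is at most (noise + D) / T. Since E noise^2 = O(T), the square
    contributes O(1/T) and the constant D contributes O(1/T^2), both uniformly in n. *)
Lemma lln_error_excess (e : R) : 0 < e -> exists2 C : R, 0 <= C &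
  forall T, 0 < T -> (\int[P]_w (excess e (lln_error tau Z mu phi T w) `^ 2)
    <= (C * (T^-1 + T^-1 ^+ 2))%:E)%E.
Proof.
move=> e0; have [D D0 hD] := lln_error_before e0.
have c0 : 0 <= noise_constant.
  by apply: mulr_ge0; apply: mulr_ge0 => //; [exact: sqr_ge0|exact: sumr_ge0].
exists (2 * noise_constant + 2 * D ^+ 2).
  by rewrite addr_ge0// mulr_ge0// sqr_ge0.
move=> T T0.
have mex : measurable_fun setT
    (fun w => (excess e (lln_error tau Z mu phi T w) `^ 2)%E).
  apply: (measurableT_comp (measurable_poweR _)).
  apply: measurable_maxe => //; apply: emeasurable_funB => //.
  exact: measurable_lln_error.
apply: (le_integral_before (ltW T0)) => //; first by move=> w; exact: poweR_ge0.
move=> n; have [N hN] := hD n T T0.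
pose X w := T^-1 ^+ 2 * (2 * noise n T N w ^+ 2 + 2 * D ^+ 2).
have bn2 := bounded_rv_sqr (bounded_noise n N (ltW T0)).
have bY : bounded_rv (fun w => 2 * noise n T N w ^+ 2 + 2 * D ^+ 2).
  apply: bounded_rvD; last exact: bounded_rv_cst.
  by apply: bounded_rvM => //; exact: bounded_rv_cst.
have bX : bounded_rv X by apply: bounded_rvM => //; exact: bounded_rv_cst.
apply: (@le_trans _ _ (\int[P]_(w in [set w | (T%:E < tau n w)%E]) (X w)%:E)%E).
  apply: ge0_le_integral => //.
  - by move=> w _; exact: poweR_ge0.
  - exact: measurable_funTS.
  - by apply/measurable_EFinP; apply: measurable_funTS; case: bX.
  move=> w /= Tw; have := hN w Tw.
  have := lln_error_ge0 tau Z mu phi T w.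
  case: (lln_error tau Z mu phi T w) => [r| |]//= _; rewrite lee_fin => hr.
  have q0 : 0 <= T^-1 * (noise n T N w + D).
    by rewrite mulr_ge0 ?addr_ge0// invr_ge0 ltW.
  have -> : excess e r%:E = (Num.max (r - e) 0)%:E.
    by rewrite /excess -EFinB EFin_max.
  rewrite poweR_EFin powR_mulrn ?le_max ?lexx ?orbT// lee_fin.
  apply: (@le_trans _ _ ((T^-1 * (noise n T N w + D)) ^+ 2)).
    rewrite ler_sqr ?nnegrE ?le_max ?lexx ?orbT//.
    by rewrite ge_max q0 andbT; lra.
  rewrite exprMn /X ler_wpM2l ?sqr_ge0//.
  by have := sqr_ge0 (noise n T N w - D); lra.
apply: (@le_trans _ _ (\int[P]_w (X w)%:E)%E).
  apply: ge0_subset_integral => //.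
  - by apply/measurable_EFinP; case: bX.
  - move=> w _; rewrite lee_fin mulr_ge0 ?sqr_ge0// addr_ge0// mulr_ge0// sqr_ge0//.
rewrite -(EFin_Rintegral_bounded_rv P bX) lee_fin (Rintegral_bounded_rvZ P _ bY).
have b2 : bounded_rv (fun w => 2 * noise n T N w ^+ 2).
  by apply: bounded_rvM => //; exact: bounded_rv_cst.
rewrite (Rintegral_bounded_rvD P b2 (bounded_rv_cst _ _)) (Rintegral_bounded_rvZ P _ bn2).
rewrite Rintegral_probability_cst.
have := noise_second_moment n N (ltW T0).
set y := \int[P]_w _; set c := noise_constant => yc.
have T'0 : 0 < T^-1 by rewrite invr_gt0.
apply: (@le_trans _ _ (T^-1 ^+ 2 * (2 * (c * T) + 2 * D ^+ 2))).
  by rewrite ler_wpM2l ?sqr_ge0//; lra.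
have -> : T^-1 ^+ 2 * (2 * (c * T) + 2 * D ^+ 2)
    = 2 * c * T^-1 + 2 * D ^+ 2 * T^-1 ^+ 2.
  by field; rewrite gt_eqF.
have h1 : 0 <= c * T^-1 ^+ 2 by rewrite mulr_ge0 ?sqr_ge0.
have h2 : 0 <= D ^+ 2 * T^-1 by rewrite mulr_ge0 ?sqr_ge0// ltW.
rewrite mulrDr !mulrDl; lra.
Qed.

End lln_estimate.

(** * From the second-moment bound to both modes of convergence *)

Section lln_final.
Context (disp : measure_display) (Omega : measurableType disp) (R : realType).
Context (P : probability Omega R) (d : nat).
Context (tau : nat -> Omega -> \bar R) (Z : nat -> Omega -> 'I_d).
Context (mu : 'cV[R]_d) (phi : 'I_d -> 'I_d -> R -> R).
Hypothesis mu_ge0 : forall i, 0 <= mu i ord0.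
Hypothesis phi_ge0 : forall i j (t : R), 0 <= t -> 0 <= phi i j t.
Hypothesis phi_measurable :
  forall i j, measurable_fun (`[0, +oo[ : set R) (phi i j).
Hypothesis hawkes : is_hawkes P tau Z mu phi.
Hypothesis phi_integrable : forall i j,
  (\int[lebesgue_measure]_(t in `[0%R, +oo[) (phi i j t)%:E < +oo)%E.
Hypothesis rho_lt1 : spectral_radius (kernel_integral phi) < 1.

Let mpp : is_marked_point_process tau Z := hawkes.1.
Local Notation V := (lln_error tau Z mu phi).
Local Notation m i := (lln_limit mu phi i ord0).

Let m_ge0 i : 0 <= m i.
Proof. exact: (lln_limit_ge0 mu_ge0 phi_ge0 rho_lt1). Qed.

Let measurable_excess (e T : R) : 0 < T ->
  measurable_fun setT (fun w => (excess e (V T w) `^ 2)%E).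
Proof.
move=> T0; apply: (measurableT_comp (measurable_poweR _)).
apply: measurable_maxe => //; apply: emeasurable_funB => //.
exact: measurable_lln_error.
Qed.

Let measurable_V2 (T : R) : 0 < T -> measurable_fun setT (fun w => (V T w `^ 2)%E).
Proof.
move=> T0; apply: (measurableT_comp (measurable_poweR _)).
exact: measurable_lln_error.
Qed.

Lemma lln_error_second_moment (e : R) : 0 < e -> exists2 C : R, 0 <= C &
  forall T, 0 < T -> (\int[P]_w (V T w `^ 2)
    <= (2 * e ^+ 2 + C * (T^-1 + T^-1 ^+ 2))%:E)%E.
Proof.
move=> e0; have [C C0 hC] := lln_error_excess mu_ge0 phi_ge0 phi_measurable
  hawkes phi_integrable rho_lt1 e0.
exists (2 * C); first by rewrite mulr_ge0.
move=> T T0.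
have e20 : 0 <= 2 * e ^+ 2 by rewrite mulr_ge0// sqr_ge0.
apply: (@le_trans _ _
  (\int[P]_w ((2 * e ^+ 2)%:E + 2%:E * (excess e (V T w) `^ 2)))%E).
  apply: ge0_le_integral => //.
  - by move=> w _; exact: poweR_ge0.
  - exact: measurable_V2.
  - apply: emeasurable_funD => //; apply: emeasurable_funM => //.
    exact: measurable_excess.
  - by move=> w _; apply: poweR2_le_excess => //; exact: lln_error_ge0.
rewrite ge0_integralD//; last 2 first.
- by move=> w _; rewrite mule_ge0// poweR_ge0.
- apply: emeasurable_funM => //; exact: measurable_excess.
rewrite integral_cst// [X in (_ * X)%E](@probability_setT _ _ _ P) mule1.
rewrite ge0_integralZl//; last 2 first.
- exact: measurable_excess.
- by move=> w _; exact: poweR_ge0.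
rewrite [leRHS]EFinD; apply: leeD => //; rewrite -mulrA EFinM lee_pmul2l//.
exact: hC.
Qed.

Let Lnorm2E (f : Omega -> \bar R) : (forall w, 0 <= f w)%E ->
  (Lnorm P 2%:E f = (\int[P]_w (f w `^ 2)) `^ 2^-1)%E.
Proof.
move=> f0; rewrite unlock; congr (_ `^ _)%E; apply: eq_integral => w _.
by rewrite gee0_abs.
Qed.

Lemma in_L2_lln_error T : 0 < T -> in_L2 P (V T).
Proof.
move=> T0; split; first exact: measurable_lln_error.
rewrite Lnorm2E; last by move=> w; exact: lln_error_ge0.
apply: poweR_lty; have [C _ hC] := lln_error_second_moment ltr01.
by apply: le_lt_trans (hC T T0) _; rewrite ltry.
Qed.

(** The error at v = 1 gives N_t <= N_T <= T m + T V_T, so square integrability is inherited from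
    V_T. *)
Lemma in_L2_jump_count (t : R) i : 0 <= t -> in_L2 P (jump_count tau Z i t).
Proof.
move=> t0; split; first exact: (measurable_jump_count mpp).
rewrite Lnorm2E; last by move=> w; exact: jump_count_ge0.
(* The error bound needs T > 0, while t = 0 is allowed. *)
apply: poweR_lty; pose T := t + 1.
have T0 : 0 < T by rewrite ltr_pwDr.
have [C C0 hC] := lln_error_second_moment ltr01.
pose a := 2 * T ^+ 2; pose b := 2 * (T * m i) ^+ 2.
have a0 : 0 <= a by rewrite mulr_ge0// sqr_ge0.
have b0 : 0 <= b by rewrite mulr_ge0// sqr_ge0.
apply: (@le_lt_trans _ _ (\int[P]_w (b%:E + a%:E * (V T w `^ 2)))%E).
  apply: ge0_le_integral => //.
  - by move=> w _; exact: poweR_ge0.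
  - apply: (measurableT_comp (measurable_poweR _)).
    exact: (measurable_jump_count mpp).
  - apply: emeasurable_funD => //; apply: emeasurable_funM => //.
    exact: measurable_V2.
  move=> w _.
  have V0 := lln_error_ge0 tau Z mu phi T w.
  have N0 := jump_count_ge0 tau Z i T w.
  have N1 : (jump_count tau Z i t w <= jump_count tau Z i T w)%E.
    by apply: jump_count_nd; rewrite lerDl.
  have : (`|(T^-1)%:E * jump_count tau Z i T w - (m i)%:E| <= V T w)%E.
    have := lln_error_at_le_lln_error tau Z mu phi T w (v := 1).
    rewrite ler01 lexx => /(_ isT); apply: le_trans.
    apply: le_trans (enorm2_ge_entry _ i).
    by rewrite mulr1 mul1r.
  move: N0 V0 N1; case: (V T w) => [x| |]//; last first.
    by move=> *; rewrite poweRyr// gt0_muley ?addey ?leey// lte_fin mulr_gt0// exprn_gt0.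
  case: (jump_count tau Z i T w) => [N| |]//=; last by rewrite gt0_muley ?lte_fin ?invr_gt0.
  rewrite lee_fin => N0 x0.
  have := jump_count_ge0 tau Z i t w.
  case: (jump_count tau Z i t w) => [N'| |]//=; rewrite !lee_fin => N'0 N'N hN.
  rewrite powR_mulrn// powR_mulrn//.
  have h : N' <= T * m i + T * x.
    apply: le_trans N'N _; rewrite -mulrDr -ler_pdivrMl// -lerBlDl.
    by apply: le_trans (ler_norm _) _.
  have h0 : 0 <= T * m i + T * x by exact: le_trans h.
  have h2 : N' ^+ 2 <= (T * m i + T * x) ^+ 2 by rewrite ler_sqr ?nnegrE.
  apply: le_trans h2 _; rewrite /a /b.
  have -> : 2 * T ^+ 2 * x ^+ 2 = 2 * (T * x) ^+ 2 by ring.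
  by have := sqr_ge0 (T * m i - T * x); lra.
rewrite ge0_integralD//; last 2 first.
- by move=> w _; rewrite mule_ge0// poweR_ge0.
- apply: emeasurable_funM => //; exact: measurable_V2.
rewrite integral_cst// [X in (_ * X)%E](@probability_setT _ _ _ P) mule1.
rewrite ge0_integralZl//; last 2 first.
- exact: measurable_V2.
- by move=> w _; exact: poweR_ge0.
rewrite lte_add_pinfty ?ltry// lte_mul_pinfty ?lee_fin//.
by apply: le_lt_trans (hC T T0) _; rewrite ltry.
Qed.

Lemma Lnorm_lln_error_cvg : Lnorm P 2%:E (V T) @[T --> +oo] --> 0%E.
Proof.
apply: ge0_ereal_cvg0; first by move=> T; exact: Lnorm_ge0.
(* With e/2 the constant term is 2 (e/2)^2 = e^2/2. The other half of e^2 absorbs C (1/T + 1/T^2) <=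
   2C/T as soon as T >= 1 and T >= 4C/e^2. *)
move=> e e0; have e20 : 0 < e / 2 by rewrite divr_gt0.
have [C C0 hC] := lln_error_second_moment e20.
near=> T.
have T1 : 1 <= T by near: T; apply: nbhs_pinfty_ge; exact: num_real.
have T2 : 4 * C / e ^+ 2 <= T by near: T; apply: nbhs_pinfty_ge; exact: num_real.
have T0 : 0 < T by exact: lt_le_trans T1.
rewrite Lnorm2E; last by move=> w; exact: lln_error_ge0.
have -> : e%:E = ((e ^+ 2)%:E `^ 2^-1)%E.
  by rewrite poweR_EFin powR12_sqrt ?sqr_ge0// sqrtr_sqr gtr0_norm.
apply: gt0_ler_poweR.
- by rewrite invr_ge0.
- rewrite in_itv/= leey andbT; apply: integral_ge0 => w _; exact: poweR_ge0.
- by rewrite in_itv/= leey andbT lee_fin sqr_ge0.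
apply: le_trans (hC T T0) _; rewrite lee_fin.
have i0 : 0 < T^-1 by rewrite invr_gt0.
have i1 : T^-1 <= 1 by rewrite invf_le1.
have h1 : T^-1 ^+ 2 <= T^-1 by rewrite expr2 ger_pMl.
have h2 : C * T^-1 <= e ^+ 2 / 4.
  rewrite ler_pdivrMr// mulrAC ler_pdivlMr// mulrC.
  by rewrite -ler_pdivrMl ?exprn_gt0// mulrC.
have h3 : C * (T^-1 + T^-1 ^+ 2) <= C * (2 * T^-1).
  by rewrite ler_wpM2l//; lra.
have -> : 2 * (e / 2) ^+ 2 = e ^+ 2 / 2 by field.
lra.
Unshelve. all: by end_near. Qed.

(** Where V exceeds 2e its excess over e is at least e, so Chebyshev's inequality bounds the
    probabilities by a geometric sequence along T = 2^k, and Borel-Cantelli applies. *)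
Lemma lln_error_dyadic_ae (e : R) : 0 < e ->
  {ae P, forall w, exists k0 : nat, forall k, (k0 <= k)%N ->
    (V (2 ^+ k) w <= (2 * e)%:E)%E}.
Proof.
move=> e0; have [C C0 hC] := lln_error_excess mu_ge0 phi_ge0 phi_measurable
  hawkes phi_integrable rho_lt1 e0.
pose F k := [set w | ((2 * e)%:E < V (2 ^+ k) w)%E].
have p2 k : 0 < 2 ^+ k :> R by rewrite exprn_gt0.
have mF k : measurable (F k).
  rewrite -[X in measurable X]setTI; apply: emeasurable_fun_o_infty => //.
  exact: measurable_lln_error.
(* The bound is 2C / (e^2 2^k), written with 2^(k+1) to fit the series of [epsilon_trick0]. *)
have PF k : (P (F k) <= (4 * C / e ^+ 2 / (2 ^ k.+1)%:R)%:E)%E.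
  have h : ((e ^+ 2)%:E * P (F k) <= (C * ((2 ^+ k)^-1 + (2 ^+ k)^-1 ^+ 2))%:E)%E.
    apply: le_trans (hC _ (p2 k)).
    have <- : (\int[P]_w ((e ^+ 2)%:E * (\1_(F k) w)%:E))%E = ((e ^+ 2)%:E * P (F k))%E.
      rewrite ge0_integralZl//; first by rewrite integral_indic// setIT.
      - by apply/measurable_EFinP; exact: measurable_indic.
      - by rewrite lee_fin sqr_ge0.
    apply: ge0_le_integral => //.
    - by move=> w _; rewrite -EFinM lee_fin mulr_ge0// sqr_ge0.
    - apply: emeasurable_funM => //; apply/measurable_EFinP.
      exact: measurable_indic.
    - exact: measurable_excess.
    move=> w _; have [wF|wF] := pselect (F k w); last first.
      by rewrite indicE memNset// mule0 poweR_ge0.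
    rewrite indicE mem_set// mule1.
    have -> : (e ^+ 2)%:E = (e%:E `^ 2)%E by rewrite poweR_EFin powR_mulrn// ltW.
    apply: gt0_ler_poweR => //.
    - by rewrite in_itv/= leey lee_fin ltW.
    - by rewrite in_itv/= leey /excess le_max lexx orbT.
    rewrite /excess le_max; apply/orP; left.
    rewrite leeBrDr// -EFinD; apply: le_trans (ltW wF).
    by rewrite lee_fin; lra.
  have e2 : 0 < e ^+ 2 by rewrite exprn_gt0.
  rewrite -(lee_pmul2l _ (_ : (0 < (e ^+ 2)%:E)%E))// -EFinM.
  apply: le_trans h _; rewrite lee_fin natrX [2 ^+ k.+1]exprS.
  have i1 : (2 ^+ k)^-1 <= 1 :> R.
    by rewrite invf_le1// -natrX ler1n expn_gt0.
  have i0 : 0 < (2 ^+ k)^-1 :> R by rewrite invr_gt0.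
  have h1 : (2 ^+ k)^-1 ^+ 2 <= (2 ^+ k)^-1 :> R by rewrite expr2 ger_pMl.
  have -> : e ^+ 2 * (4 * C / e ^+ 2 / (2 * 2 ^+ k)) = C * (2 * (2 ^+ k)^-1).
    by field; rewrite !gt_eqF.
  by rewrite ler_wpM2l//; lra.
have PF0 : P (lim_sup_set F) = 0%E.
  apply: lim_sup_set_cvg0 => //.
  apply: (@le_lt_trans _ _ (\sum_(0 <= k <oo) (4 * C / e ^+ 2 / (2 ^ k.+1)%:R)%:E)%E).
    by apply: lee_nneseries => k _ *; [exact: measure_ge0|exact: PF].
  apply: le_lt_trans (epsilon_trick0 _ _) (ltry _).
  by rewrite divr_ge0 ?sqr_ge0// mulr_ge0.
exists (lim_sup_set F); split => //.
  apply: bigcap_measurable => // k _; apply: bigcup_measurable => j _.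
  exact: mF.
move=> w /= nw n _; apply: contrapT => nF; apply: nw; exists n => k nk.
by rewrite leNgt; apply/negP => h; apply: nF; exists k.
Qed.

(** Only the countably many levels 1/(q + 1) are used, so that a single null set serves for all of
    them. *)
Lemma lln_error_ae : {ae P, forall w, V T w @[T --> +oo] --> 0%E}.
Proof.
have := ae_foralln (fun q : nat => lln_error_dyadic_ae (_ : 0 < q.+1%:R^-1 :> R)).
move=> /(_ (fun q => _)) H.
have {}H : {ae P, forall w, forall q : nat, exists k0 : nat, forall k, (k0 <= k)%N ->
    (V (2 ^+ k) w <= (2 * q.+1%:R^-1)%:E)%E}.
  by apply: H => q; rewrite invr_gt0.
apply: filterS H => w hw; apply: ge0_ereal_cvg0.
  by move=> T; exact: lln_error_ge0.
(* The level 1/(q + 1) is multiplied by 2 in the dyadic statement and by 2 again when passing from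
   2^j to T, hence 4/e. *)
move=> e e0; pose q := Num.truncn (4 / e).
have [k0 hk0] := hw q.
near=> T.
have T0 : 2 ^+ k0 < T by near: T; apply: nbhs_pinfty_gt; exact: num_real.
have T0' : 0 < T by apply: lt_trans T0; rewrite exprn_gt0.
have exj : exists j, T <= 2 ^+ j.
  exists (Num.truncn T).+1; apply: le_trans (ltW (truncnS_gt T)) _.
  by rewrite -natrX ler_nat ltnW// ltn_expl.
(* By minimality of j, T lies above 2^(j-1), which bounds the rescaling factor 2^j / T by 2. *)
have [j hj jmin] := ex_minnP exj.
have kj : (k0 < j)%N.
  rewrite ltnNge; apply/negP => jk.
  have : (2 : R) ^+ j <= 2 ^+ k0 by rewrite ler_weXn2l// ler1n.
  by move=> /(le_trans hj); rewrite leNgt T0.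
have Tj : 2 ^+ j / T <= 2.
  rewrite ler_pdivrMr//; case: j hj jmin kj => // j hj jmin kj.
  rewrite exprS ler_pM2l// leNgt; apply/negP => h.
  by have := jmin j (ltW h); rewrite ltnn.
apply: le_trans (lln_error_scale tau Z mu phi w T0' hj) _.
apply: (@le_trans _ _ (2%:E * (2 * q.+1%:R^-1)%:E)%E).
  apply: lee_pmul.
  - by rewrite lee_fin divr_ge0 ?(ltW T0')// exprn_ge0.
  - exact: lln_error_ge0.
  - by rewrite lee_fin.
  - exact: hk0 (ltnW kj).
rewrite -EFinM lee_fin mulrA ler_pdivrMr// [leRHS]mulrC -ler_pdivrMr//.
have -> : 2 * 2 = 4 :> R by ring.
exact: ltW (truncnS_gt _).
Unshelve. all: by end_near. Qed.

End lln_final.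

Theorem theorem1 (disp : measure_display) (Omega : measurableType disp)
    (R : realType) (P : probability Omega R) (d : nat)
    (tau : nat -> Omega -> \bar R) (Z : nat -> Omega -> 'I_d)
    (mu : 'cV[R]_d) (phi : 'I_d -> 'I_d -> R -> R)
    (mu_ge0 : forall i, 0 <= mu i ord0)
    (phi_ge0 : forall i j (t : R), 0 <= t -> 0 <= phi i j t)
    (phi_measurable : forall i j, measurable_fun (`[0, +oo[ : set R) (phi i j))
    (hawkes : is_hawkes P tau Z mu phi)
    (phi_integrable : forall i j,
      (\int[lebesgue_measure]_(t in `[0%R, +oo[) (phi i j t)%:E < +oo)%E)
    (rho_lt1 : spectral_radius (kernel_integral phi) < 1) :
  [/\ forall (t : R) i, 0 <= t -> in_L2 P (jump_count tau Z i t),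
      {ae P, forall w,
        lln_error tau Z mu phi T w @[T --> +oo] --> 0%E},
      forall T, 0 < T -> in_L2 P (lln_error tau Z mu phi T) &
      Lnorm P 2%:E (lln_error tau Z mu phi T) @[T --> +oo] --> 0%E].
Proof.
split.
- move=> t i.
  exact: (in_L2_jump_count mu_ge0 phi_ge0 phi_measurable hawkes phi_integrable rho_lt1).
- exact: (lln_error_ae mu_ge0 phi_ge0 phi_measurable hawkes phi_integrable rho_lt1).
- exact: (in_L2_lln_error mu_ge0 phi_ge0 phi_measurable hawkes phi_integrable rho_lt1).
- exact: (Lnorm_lln_error_cvg mu_ge0 phi_ge0 phi_measurable hawkes phi_integrable rho_lt1).
Qed.
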